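(* Let $n=2r$ be a positive multiple of $4$ and let $F$ be a field with $\operatorname{char}F=0$ or $\operatorname{char}F>r$. Let $V$ be the scheme of $n\times n$ matrices $Y=(Y_{ij})$ over $\operatorname{Spec}F$ such that $$Y=-Y^T,\qquad Y_{ii}=0\ (1\le i\le n),\qquad Y^TJY=0,\qquad \operatorname{char}_{(-JY)}(T)=T^n,$$ where $J=\begin{bmatrix}0&I_r\\-I_r&0\end{bmatrix}$. Then the coordinate ring $F[V]$ is an integral domain.
   Context: $\operatorname{char}_{(-JY)}(T)$ denotes the characteristic polynomial of $-JY$. $F[V]$ is the quotient of the polynomial ring $F[Y_{ij}:1\le i,j\le n]$ by the ideal generated by the polynomial equations that the displayed conditions impose on the entries of $Y$. *)

(* Defs.v *)
From HB Require Import structures.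
From mathcomp Require Import all_boot all_order all_algebra.
From mathcomp Require Import boolp.
From mathcomp Require Import mpoly.

Set Implicit Arguments.
Unset Strict Implicit.
Unset Printing Implicit Defensive.

Import GRing.Theory.
Local Open Scope ring_scope.

Definition ideal_generated_by (R : comNzRingType) (S : R -> Prop) (p : R) : Prop :=
  exists (k : nat) (a g : 'I_k -> R),
    (forall i, S (g i)) /\ p = \sum_(i < k) a i * g i.

Definition is_integral_domain (R : comNzRingType) : Prop :=
  (1 : R) <> 0 /\ forall x y : R, x * y = 0 -> x = 0 \/ y = 0.

Definition symplectic_mx (R : pzRingType) (r : nat) : 'M[R]_(r + r) :=
  block_mx 0 1%:M (- 1%:M) 0.

(* F[Y_ij : 1 <= i, j <= n], the indeterminate Y_ij being the one numbered
   mxvec_index i j. *)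
Notation mxpolyring F n := {mpoly F[n * n]}.

Definition generic_mx (F : fieldType) (n : nat) : 'M[mxpolyring F n]_n :=
  \matrix_(i, j) 'X_(mxvec_index i j).

Section CoordinateRing.

Variables (F : fieldType) (r : nat).

Local Notation n := (r + r)%N.
Local Notation P := (mxpolyring F n).
Local Notation Y := (generic_mx F n).
Local Notation J := (symplectic_mx P r).

(* The polynomials that have to vanish at a matrix for it to satisfy the four
   conditions defining V: differences of entries of the two sides of each
   matrix equation, and differences of coefficients of the two sides of the
   equation between characteristic polynomials. *)
Inductive V_equation : P -> Prop :=
| V_skew (i j : 'I_n) : V_equation (Y i j - (- Y^T) i j)
| V_diag (i : 'I_n) : V_equation (Y i i)
| V_isotropic (i j : 'I_n) : V_equation ((Y^T *m J *m Y) i j)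
| V_char_poly (k : nat) :
    V_equation ((char_poly (- (J *m Y)))`_k - ('X^n : {poly P})`_k).

Definition V_ideal : {pred P} := fun p => `[< ideal_generated_by V_equation p >].

(* The zero matrix satisfies all the equations, so 1 is not in the ideal; this
   is what makes the quotient a nonzero ring. *)
Lemma V_equation0 p : V_equation p -> p.@[fun=> 0] = 0.
Proof.
pose f : {rmorphism P -> F} := meval (fun=> 0).
have fY : map_mx f Y = 0.
  by apply/matrixP => i j; rewrite !mxE; exact: mevalXU.
have fYE i j : f (Y i j) = 0.
  by have := congr1 (fun A : 'M_n => A i j) fY; rewrite !mxE.
move=> Vp; change (f p = 0); case: Vp => [i j|i|i j|k].
- have -> : (- Y^T) i j = - Y j i by rewrite !mxE.
  by rewrite rmorphB rmorphN !fYE oppr0 subr0.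
- exact: fYE.
- rewrite mxE rmorph_sum big1 // => l _.
  by rewrite rmorphM fYE mulr0.
rewrite rmorphB -!(coef_map f) map_polyXn map_char_poly map_mxN map_mxM fY.
rewrite mulmx0 oppr0 /char_poly /char_poly_mx map_mx0 subr0 det_scalar.
by rewrite subrr.
Qed.

Fact V_ideal_closed : idealr_closed V_ideal.
Proof.
split.
- apply/asboolP; exists 0%N, (fun=> 0), (fun=> 0).
  by split=> [[]//|]; rewrite big_ord0.
- apply/asboolP => -[k [a [g [Vg /(congr1 (meval (fun=> 0)))]]]].
  rewrite rmorph1 rmorph_sum big1 => [/eqP|i _]; first by rewrite oner_eq0.
  by rewrite rmorphM /= (V_equation0 (Vg i)) mulr0.
move=> b u v /asboolP[k [a [g [Vg ->]]]] /asboolP[l [c [h [Vh ->]]]].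
apply/asboolP; exists (k + l)%N.
exists (fun i => match split i with inl i => b * a i | inr i => c i end).
exists (fun i => match split i with inl i => g i | inr i => h i end).
split=> [i|]; first by case: split.
rewrite big_split_ord mulr_sumr; congr (_ + _); apply: eq_bigr => i _.
  by rewrite (unsplitK (inl i)) mulrA.
by rewrite (unsplitK (inr i)).
Qed.

HB.instance Definition _ := isIdealr.Build P V_ideal V_ideal_closed.

Definition coordinate_ring : comNzRingType := {ideal_quot V_ideal}.

End CoordinateRing.

(* Main.v *)
Require Import Defs.
From mathcomp Require Import all_boot all_order all_algebra.
From mathcomp Require Import boolp mpoly ring zify.

(** Let I be the ideal of V in F[Y]. Any kernel of a ring morphism to a domain is
prime, so it is enough to present I as such a kernel; the morphism is given by a
generic point of V. Let Omega be the standard alternating matrix of even size r, and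
let C be a generic n x r matrix with isotropic columns, C^T J C = 0. The matrix
C Omega C^T is alternating, Y^T J Y vanishes at it because C^T J C does, and then
(-JY)^2 = 0, so that its characteristic polynomial is T^n. Hence the morphism
Y |-> C Omega C^T kills I ([frame_map_equation]). The work is to show that its kernel
is not larger.

The indices of Y are written as letters 0, ..., n-1, where J pairs the letters 2p and
2p+1. To an increasing sequence of letters of even length, a column, belongs a Pfaffian
of Y; to a semistandard tableau with even columns, the product of the Pfaffians of its
columns. Three facts about these products give the theorem.

They form a basis of the polynomials in the Y_ab with a < b ([std_basis]). For a matrix C of independent variables and
well chosen weights, the Pfaffian of C Omega C^T for the column c_0 < c_1 < ... has a
single monomial of least weight, the product of the entries (c_i, i) of C
([pf_blocks_lowest]). Different tableaux therefore have different lowest monomials, and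
their products are linearly independent. They span because there are enough of them: a
version of row insertion embeds the monomials of a given content into the tableaux of
the same content ([rsk_inj]).

Modulo I, the tableaux with c_i >= 2i in their columns suffice; these are King's
symplectic tableaux. Contracting a Pfaffian with J gives an element of I, since it
involves only the trace of JY and the entries of Y^T J Y ([contract_head]). If a column
has c_i < 2i for some i, suitable combinations of contractions express m! times its
Pfaffian, for some m <= r, by Pfaffians of columns with later letters
([column_straighten]). This is the only place where the assumption on the characteristic
enters, apart from dividing by 2. Expanding again in the basis and repeating, the
letters only move to later pairs, so that the process ends ([content_reducible]).

Finally, symplectic tableaux remain independent at the generic point. On frames with
isotropic columns the entries (a, i) with 2i <= a can be taken as free coordinates, up
to a normalization, while the other ones are polynomials in these; the weights can be
chosen so that the dependent entries do not affect lowest monomials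
([iso_frame_ge]). So the products indexed by symplectic tableaux again have distinct
lowest monomials, and a polynomial in the kernel, being congruent modulo I to a
combination of such products, is congruent to 0 ([generic_point_kernel]). *)

Set Implicit Arguments.
Unset Strict Implicit.
Unset Printing Implicit Defensive.

(** * Row insertion for monomials in an alternating matrix *)

(** Gelfand-Tsetlin patterns encode semistandard tableaux: [lam c] lists the row lengths
of the part of the tableau that is filled with letters smaller than [c]. *)
Definition gt_pattern (lam : nat -> nat -> nat) :=
  (forall i, lam 0 i = 0) /\
  forall c i, lam c i <= lam c.+1 i /\ lam c.+1 i.+1 <= lam c i.

(** In terms of row lengths, this says that all columns have even length. *)
Definition even_shape (f : nat -> nat) := forall i, f i.*2.+1 = f i.*2.

Section Insertion.
Variables (lam : nat -> nat -> nat) (m : nat -> nat).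

(** Row insertion into the tableau [lam] of a word with [m a] letters [a], taken in
increasing order, seen on the letters smaller than [c]. This is Fomin's local rule, by
which three neighbouring shapes and one multiplicity determine the fourth shape. *)
Fixpoint row_insert c : nat -> nat :=
  if c is c'.+1 then fun i =>
    if i is i'.+1 then
      maxn (row_insert c' i) (lam c i) + minn (row_insert c' i') (lam c i') - lam c' i'
    else maxn (row_insert c' 0) (lam c 0) + m c'
  else fun=> 0.

Hypothesis gt_lam : gt_pattern lam.

(** The new boxes form a horizontal strip, because the inserted word is increasing. *)
Lemma row_insert_strip c i : lam c i <= row_insert c i /\ row_insert c i.+1 <= lam c i.
Proof.
have [lam0 lamS] := gt_lam.
elim: c i => [|c IH] i; first by rewrite /= lam0.
have h1 := IH i; have h2 := IH i.+1; have h3 := lamS c i; have h4 := lamS c i.+1.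
split; last by move: h1 h2 h3 h4 => /=; lia.
case: i {h1 h2 h3 h4} => [|i] /=; first by lia.
by have h1 := IH i; have h2 := IH i.+1; have h3 := lamS c i; lia.
Qed.

Lemma row_insert_interlace c i :
  row_insert c i <= row_insert c.+1 i /\ row_insert c.+1 i.+1 <= row_insert c i.
Proof.
have [_ lamS] := gt_lam.
have h1 := row_insert_strip c i; have h2 := row_insert_strip c i.+1.
have h3 := lamS c i; have h4 := lamS c i.+1.
split; last by move: h1 h2 h3 h4 => /=; lia.
case: i {h1 h2 h3 h4} => [|i] /=; first by lia.
by have h1 := row_insert_strip c i; have h2 := row_insert_strip c i.+1;
  have h3 := lamS c i; lia.
Qed.

Lemma gt_pattern_zero c i : c <= i -> lam c i = 0.
Proof.
have [lam0 lamS] := gt_lam.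
elim: c i => [|c IH] [|i] //= le_ci.
by have := lamS c i; rewrite IH //; lia.
Qed.

Lemma gt_pattern_mono c c' i : c <= c' -> lam c i <= lam c' i.
Proof.
move=> /subnK <-; elim: (c' - c) => // k IH; rewrite addSn.
by apply: leq_trans IH _; have [] := gt_lam.2 (k + c) i.
Qed.

(** The local rule neither creates nor loses boxes, as a maximum and a minimum of two
numbers add up to their sum. *)
Lemma row_insert_size N c : c <= N ->
  \sum_(i < N.+1) row_insert c i = \sum_(i < N.+1) lam c i + \sum_(a < c) m a.
Proof.
elim: c => [|c IH] le_cN.
  by rewrite big_ord0 addn0; apply: eq_bigr => i _; rewrite /= gt_lam.1.
have eqc := IH (ltnW le_cN); rewrite [X in _ = _ + X]big_ord_recr [X in _ = _ + X]/=.
pose mx i := maxn (row_insert c i) (lam c.+1 i).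
pose mn i := minn (row_insert c i) (lam c.+1 i).
have e1 : \sum_(i < N.+1) mx i + \sum_(i < N.+1) mn i =
          \sum_(i < N.+1) row_insert c i + \sum_(i < N.+1) lam c.+1 i.
  by rewrite -!big_split; apply: eq_bigr => i _; rewrite /= /mx /mn; lia.
have e2 : \sum_(i < N) (mx i.+1 + mn i - lam c i) + \sum_(i < N) lam c i =
          \sum_(i < N) mx i.+1 + \sum_(i < N) mn i.
  rewrite -!big_split; apply: eq_bigr => i _; rewrite /= /mx /mn.
  have := row_insert_strip c i; have := gt_lam.2 c i; lia.
have e3 : \sum_(i < N.+1) row_insert c.+1 i =
    mx 0 + m c + \sum_(i < N) (mx i.+1 + mn i - lam c i) by rewrite big_ord_recl.
have e4 : \sum_(i < N.+1) mx i = mx 0 + \sum_(i < N) mx i.+1 by rewrite big_ord_recl.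
have e5 : \sum_(i < N.+1) mn i = \sum_(i < N) mn i.
  by rewrite big_ord_recr /= {2}/mn (gt_pattern_zero le_cN) minn0 addn0.
have e6 : \sum_(i < N.+1) lam c i = \sum_(i < N) lam c i.
  by rewrite big_ord_recr /= (gt_pattern_zero (ltnW le_cN)) addn0.
rewrite [\sum_(i < N.+1) row_insert _ i]e3; move: e1 e2 e4 e5 e6 eqc.
move: (\sum_(i < N.+1) row_insert c i) (\sum_(i < N.+1) lam c.+1 i) => A1 A2.
move: (\sum_(i < N.+1) mx i) (\sum_(i < N.+1) mn i) (\sum_(i < N.+1) lam c i) => A3 A4 A5.
move: (\sum_(i < N) _) (\sum_(i < N) mx i.+1) (\sum_(i < N) mn i) => A6 A7 A8.
move: (\sum_(i < N) lam c i) (\sum_(i < c) m i) (mx 0) => A9 A10 A11.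
lia.
Qed.
End Insertion.

(** The local rule can be run backwards: row [i.+1] of the fourth shape determines row [i]
of the first one, and row 0 determines the multiplicity. *)
Lemma row_insert_inj lam lam' m m' b :
    gt_pattern lam -> gt_pattern lam' -> (forall i, lam b i = lam' b i) ->
    (forall c i, c <= b -> row_insert lam m c i = row_insert lam' m' c i) ->
  (forall c i, c <= b -> lam c i = lam' c i) /\ (forall c, c < b -> m c = m' c).
Proof.
move=> gt gt' eq_b; elim: b eq_b => [|b IH] eq_b eq_ins.
  by split=> // [[|c] i] // _; apply: eq_b.
have eq_b' i : lam b i = lam' b i.
  have := eq_ins b.+1 i.+1 (leqnn _); rewrite /= !eq_b !(eq_ins b) //.
  have := row_insert_strip m gt b i; have := row_insert_strip m' gt' b i.
  by have := gt.2 b i; have := gt'.2 b i; rewrite !eq_b !(eq_ins b) //; lia.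
have [eq_lam eq_m] := IH eq_b' (fun c i le_c => eq_ins c i (leqW le_c)).
split=> c; first by move=> i; rewrite leq_eqVlt => /orP[/eqP->|/eq_lam].
rewrite ltnS leq_eqVlt => /orP[/eqP->|/eq_m] //.
by have := eq_ins b.+1 0 (leqnn _); rewrite /= !eq_b !(eq_ins b) //; lia.
Qed.

(** The letter [b] is put under each column that row insertion has left with an odd
length: row 2i+1 becomes as long as row 2i. *)
Definition add_letter (lam : nat -> nat -> nat) m b c i :=
  if c <= b then row_insert lam m c i else row_insert lam m b (i./2).*2.

Lemma add_letter_gt lam m b : gt_pattern lam -> gt_pattern (add_letter lam m b).
Proof.
move=> gt; rewrite /add_letter; split=> [i|c i]; first by rewrite leq0n.
have par j k : j <= k -> row_insert lam m b k <= row_insert lam m b j.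
  move=> /subnK <-; elim: (k - j) => // l IHl; rewrite addSn; apply: leq_trans IHl.
  by have := row_insert_strip m gt b (l + j); lia.
case: (ltngtP c b) => [lt_cb|lt_bc|->].
- exact: row_insert_interlace.
- by split=> //; apply: par; lia.
split; apply: par; lia.
Qed.

Lemma add_letter_even lam m b : even_shape (add_letter lam m b b.+1).
Proof.
by move=> i; rewrite /add_letter ltnn; congr (row_insert lam m b _); lia.
Qed.

(** The step is reversible: since a horizontal strip was added to a shape with even
columns, rows 2i and 2i+1 of that shape are as long as row 2i+1 of the result. *)
Lemma even_shape_row_insert lam m b i : gt_pattern lam -> even_shape (lam b) ->
  lam b i = row_insert lam m b (i./2).*2.+1.
Proof.
move=> gt even; have := even i./2.
have := row_insert_strip m gt b (i./2).*2; have := row_insert_strip m gt b (i./2).*2.+1.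
have := odd_double_half i; case: (odd i) => /= eqi; move: (i./2) eqi => j <-.
  by rewrite add1n; lia.
by rewrite add0n; lia.
Qed.

Lemma add_letter_inj lam lam' m m' b :
    gt_pattern lam -> gt_pattern lam' ->
    even_shape (lam b) -> even_shape (lam' b) ->
    (forall c i, c <= b.+1 -> add_letter lam m b c i = add_letter lam' m' b c i) ->
  (forall c i, c <= b -> lam c i = lam' c i) /\ (forall c, c < b -> m c = m' c).
Proof.
move=> gt gt' even even' eqx.
have eq_ins c i : c <= b -> row_insert lam m c i = row_insert lam' m' c i.
  by move=> le_cb; have := eqx c i (leqW le_cb); rewrite /add_letter le_cb.
apply: row_insert_inj => // i.
by rewrite (even_shape_row_insert m _ gt) // (even_shape_row_insert m' _ gt') // eq_ins.
Qed.

Lemma sum_double K (f : nat -> nat) : \sum_(i < K.*2) f i = \sum_(i < K) (f i.*2 + f i.*2.+1).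
Proof.
elim: K => [|K IH]; first by rewrite !big_ord0.
by rewrite doubleS !big_ord_recr /= IH addnA.
Qed.

Lemma add_letter_size lam m b K c : b < K.*2 -> gt_pattern lam -> even_shape (lam b) ->
  \sum_(i < K.*2) add_letter lam m b c i =
  \sum_(i < K.*2) lam (minn c b) i + \sum_(a < b) m a * ((a < c) + (b < c)).
Proof.
move=> lt_bK gt even.
have [N eqN] : exists N, K.*2 = N.+1 by exists K.*2.-1; lia.
have le_bN : b <= N by lia.
rewrite /add_letter; case: (leqP c b) => [le_cb | lt_bc].
  rewrite eqN (row_insert_size m gt (leq_trans le_cb le_bN)); congr (_ + _).
  rewrite (big_ord_widen b m le_cb) [RHS](bigID (fun a : 'I_b => a < c)) /=.
  rewrite [X in _ = _ + X]big1 => [|a /negPf->]; last by rewrite muln0.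
  rewrite addn0.
  by apply: eq_bigr => a ->; rewrite muln1.
have e1 := row_insert_size m gt le_bN.
rewrite -eqN (sum_double K (row_insert lam m b)) (sum_double K (lam b)) in e1.
rewrite (sum_double K (lam b)).
rewrite (sum_double K (fun i => row_insert lam m b (i./2).*2)).
have e2 : \sum_(i < K) (lam b i.*2 + lam b i.*2.+1) =
          2 * \sum_(i < K) row_insert lam m b i.*2.+1.
  rewrite big_distrr; apply: eq_bigr => i _ /=.
  by rewrite even (even_shape_row_insert m _ gt even) doubleK; lia.
have e3 : \sum_(i < K) (row_insert lam m b (i.*2)./2.*2 + row_insert lam m b (i.*2.+1)./2.*2) =
          2 * \sum_(i < K) row_insert lam m b i.*2.
  rewrite big_distrr; apply: eq_bigr => i _ /=.
  have -> : (uphalf i.*2).*2 = i.*2 by lia.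
  by rewrite doubleK; lia.
have e4 : \sum_(a < b) m a * ((a < c) + 1) = 2 * \sum_(a < b) m a.
  rewrite big_distrr; apply: eq_bigr => a _ /=.
  by rewrite (ltn_trans (ltn_ord a) lt_bc) mulnC.
rewrite [LHS]e3 e4; move: e1; rewrite big_split /= e2.
move: (\sum_(i < K) row_insert lam m b i.*2) (\sum_(i < K) row_insert lam m b i.*2.+1) => A1 A2.
by move: (\sum_(a < b) m a) => A3; lia.
Qed.

Lemma sum_eq_lt a c : \sum_(x < c) (a == x :> nat) = (a < c).
Proof.
elim: c => [|c IH]; first by rewrite big_ord0.
by rewrite big_ord_recr /= IH; lia.
Qed.

(** The Robinson-Schensted-Knuth correspondence for alternating matrices: the monomial with
exponents [m a b], for [a < b], becomes a semistandard tableau with even columns. *)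
Fixpoint rsk (m : nat -> nat -> nat) b : nat -> nat -> nat :=
  if b is b'.+1 then add_letter (rsk m b') (m^~ b') b' else fun _ _ => 0.

Lemma rsk_gt_even m b : gt_pattern (rsk m b) /\ even_shape (rsk m b b).
Proof.
elim: b => [|b [gt even]] //=; split; last exact: add_letter_even.
exact: add_letter_gt.
Qed.

Lemma rsk_inj m m' b :
    (forall c i, c <= b -> rsk m b c i = rsk m' b c i) ->
  forall a c, a < c -> c < b -> m a c = m' a c.
Proof.
elim: b => // b IH eqb a c lt_ac.
have [gt even] := rsk_gt_even m b; have [gt' even'] := rsk_gt_even m' b.
have [eq_rsk eqm] := add_letter_inj gt gt' even even' eqb.
rewrite ltnS leq_eqVlt => /orP[/eqP eqc|]; last exact: IH.
by subst c; apply: eqm.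
Qed.

(** The degree in the letter [x] of the monomial with exponents [m a b], for [a < b]. *)
Definition letter_count (m : nat -> nat -> nat) n x :=
  \sum_(b < n) \sum_(a < b) m a b * ((a == x :> nat) + (b == x :> nat)).

Lemma rsk_size m K b c : b <= K.*2 ->
  \sum_(i < K.*2) rsk m b c i = \sum_(x < c) letter_count m b x.
Proof.
elim: b c => [|b IH] c le_bK.
  by rewrite /= !big1 // => x _; rewrite /letter_count big_ord0.
have [gt even] := rsk_gt_even m b.
rewrite /= add_letter_size // (IH _ (ltnW le_bK)).
rewrite [RHS](eq_bigr (fun x : 'I_c => letter_count m b x +
   \sum_(a < b) m a b * ((a == x :> nat) + (b == x :> nat)))); last first.
  by move=> x _; rewrite /letter_count big_ord_recr.
rewrite big_split /=; congr (_ + _).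
  case: (leqP c b) => // le_bc.
  rewrite (big_ord_widen_cond c xpredT (letter_count m b) (ltnW le_bc)) /=.
  rewrite [RHS](bigID (fun x : 'I_c => x < b)) /= [X in _ = _ + X]big1 ?addn0 //.
  move=> x; rewrite -leqNgt => le_bx; rewrite /letter_count big1 // => b' _.
  rewrite big1 // => a _; have := ltn_ord b'; have := ltn_ord a => lt1 lt2.
  have [-> ->] : (a == x :> nat) = false /\ (b' == x :> nat) = false by lia.
  by rewrite muln0.
rewrite exchange_big; apply: eq_bigr => a _ /=.
by rewrite -big_distrr /= big_split /= !sum_eq_lt.
Qed.

Lemma rsk_size_even m n c : ~~ odd n ->
  \sum_(i < n) rsk m n c i = \sum_(x < c) letter_count m n x.
Proof.
by move=> even_n; have := @rsk_size m n./2 n c; rewrite (even_halfK even_n) leqnn => ->.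
Qed.

(** * Columns of semistandard tableaux *)

Lemma sum_lt_le k L : k <= L -> \sum_(j < L) (j < k) = k.
Proof.
elim: L k => [|L IH] k le_kL; first by rewrite big_ord0; lia.
rewrite big_ord_recr /=; case: (ltnP L k) => [lt_Lk|le_kL'].
  have -> : k = L.+1 by lia.
  rewrite -[L in RHS](IH L (leqnn _)) addn1; congr _.+1.
  by apply: eq_bigr => j _; rewrite ltn_ord ltnS ltnW.
by rewrite IH // addn0.
Qed.

Lemma ltn_count_iota (q : pred nat) n i :
  (forall i' i0, i' <= i0 -> q i0 -> q i') -> i < n -> (i < count q (iota 0 n)) = q i.
Proof.
move=> q_anti; elim: n => // n IH.
have -> : iota 0 n.+1 = rcons (iota 0 n) n by rewrite -addn1 iotaD cats1.
rewrite -cats1 count_cat /= addn0 ltnS => le_in.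
have le_c : count q (iota 0 n) <= n by rewrite -[leqRHS](size_iota 0) count_size.
case: (boolP (q n)) => [qn|nqn].
  have /eqP-> : count q (iota 0 n) == n.
    rewrite -[X in _ == X](size_iota 0) -all_count; apply/allP => i'.
    by rewrite mem_iota => /andP[_ lt_i]; apply: q_anti qn; lia.
  by rewrite addn1 ltnS le_in (q_anti _ _ le_in qn).
rewrite addn0; move: le_in; rewrite leq_eqVlt => /orP[/eqP->|]; last exact: IH.
by rewrite (negPf nqn) ltnNge le_c.
Qed.

Section Tableau.
Variables (lam : nat -> nat -> nat) (n : nat).

(** The entry of the tableau in row [i] and column [j]; it is [n] outside the shape. *)
Definition letter i j := \sum_(c < n) (lam c.+1 i <= j).
Definition height j := count (fun i => j < lam n i) (iota 0 n).
Definition column j := [seq letter i j | i <- iota 0 (height j)].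
Definition multiplicity a i := \sum_(j < lam n 0) (letter i j == a).

Hypothesis gt_lam : gt_pattern lam.

Lemma sum_leq_bool (P : pred nat) m : (\sum_(c < m) P c <= m).
Proof.
rewrite -[leqRHS]muln1 -[m in leqRHS]card_ord -sum_nat_const.
by apply: leq_sum => i _; apply: leq_b1.
Qed.

Lemma letter_lt c i j : c <= n -> (letter i j < c) = (j < lam c i).
Proof.
move=> le_cn; rewrite /letter.
have split : \sum_(x < n) (lam x.+1 i <= j) =
    \sum_(x < c) (lam x.+1 i <= j) + \sum_(c <= x < n) (lam x.+1 i <= j).
  by rewrite -!(big_mkord xpredT (fun x => nat_of_bool (lam x.+1 i <= j))) -big_cat_nat.
rewrite split; case: (ltnP j (lam c i)) => [lt_j|le_j].
  have -> : \sum_(c <= x < n) (lam x.+1 i <= j) = 0.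
    rewrite big_nat big1 // => x /andP[le_cx _].
    by have := @gt_pattern_mono _ gt_lam c x.+1 i (leqW le_cx); lia.
  rewrite addn0.
  case: c le_cn split lt_j => [|c] _ _ lt_j; first by move: lt_j; rewrite gt_lam.1.
  rewrite big_ord_recr /= [lam c.+1 i <= j]leqNgt lt_j /= addn0 ltnS.
  exact: (sum_leq_bool (fun x => lam x.+1 i <= j)).
have -> : \sum_(x < c) (lam x.+1 i <= j) = c.
  rewrite -[RHS](card_ord c) -sum1_card; apply: eq_bigr => x _.
  by have := @gt_pattern_mono _ gt_lam x.+1 c i (ltn_ord x); lia.
by rewrite ltnNge leq_addr.
Qed.

Lemma gt_pattern_decr c i i' : i' <= i -> lam c i <= lam c i'.
Proof.
move=> /subnK <-; elim: (i - i') => // k IH; rewrite addSn; apply: leq_trans IH.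
by have := gt_lam.2 c (k + i'); have := gt_lam.2 c (k + i').+1; lia.
Qed.

Lemma multiplicity_sum c i : c <= n -> lam c i = \sum_(a < c) multiplicity a i.
Proof.
move=> le_cn; rewrite exchange_big /=.
rewrite -[LHS](sum_lt_le (L := lam n 0)).
  by apply: eq_bigr => j _; rewrite sum_eq_lt letter_lt.
apply: leq_trans (gt_pattern_mono gt_lam i le_cn) _.
exact: gt_pattern_decr.
Qed.

Lemma letter_gt i j : letter i j < n -> letter i j < letter i.+1 j.
Proof.
move=> lt_ij; rewrite ltnNge; apply/negP => le_ij.
have := @letter_lt (letter i j).+1 i.+1 j lt_ij; rewrite ltnS le_ij => /esym lt_j.
have := @letter_lt (letter i j) i j (ltnW lt_ij); rewrite ltnn => /esym /negP; apply.
by have := gt_lam.2 (letter i j) i; lia.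
Qed.

Lemma letter_incr i j j' : j <= j' -> letter i j <= letter i j'.
Proof. by move=> le_j; apply: leq_sum => c _; lia. Qed.

Lemma height_gt i j : (i < height j) = (j < lam n i).
Proof.
have lam_0 i0 : n <= i0 -> lam n i0 = 0 by apply: gt_pattern_zero.
case: (ltnP i n) => [lt_in|le_ni].
  rewrite /height ltn_count_iota // => i' i0 le_i lt_j.
  exact: leq_trans lt_j (gt_pattern_decr n le_i).
rewrite (lam_0 _ le_ni) ltn0; apply/negbTE; rewrite -leqNgt; apply: leq_trans le_ni.
by rewrite -[leqRHS](size_iota 0) count_size.
Qed.

Lemma height_even j : even_shape (lam n) -> ~~ odd (height j).
Proof.
move=> even; apply/negP => odd_h.
have eqh : height j = (height j)./2.*2.+1 by have := odd_double_half (height j); rewrite odd_h.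
have := height_gt (height j)./2.*2.+1 j; have := height_gt (height j)./2.*2 j.
by rewrite even -{2}eqh ltnn => <-; rewrite {2}eqh ltnSn.
Qed.

Lemma column_letter_lt j : all (fun a => a < n) (column j).
Proof.
apply/allP => _ /mapP[i i_h ->]; rewrite letter_lt // -height_gt.
by move: i_h; rewrite mem_iota.
Qed.

Lemma column_sorted j : sorted ltn (column j).
Proof.
apply/(sortedP 0) => i; rewrite size_map size_iota => lt_i.
rewrite !(nth_map 0) ?size_iota ?(ltnW lt_i) // !nth_iota ?(ltnW lt_i) // !add0n.
by apply: letter_gt; rewrite letter_lt // -height_gt ltnW.
Qed.

Lemma height_le j : height j <= n.
Proof. by rewrite -[leqRHS](size_iota 0) count_size. Qed.

Lemma sum_columns (f : nat -> nat -> nat) :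
  \sum_(j < lam n 0) \sum_(i <- iota 0 (height j)) f (letter i j) i =
  \sum_(i < n) \sum_(a < n) multiplicity a i * f a i.
Proof.
have col (j : 'I_(lam n 0)) : \sum_(i <- iota 0 (height j)) f (letter i j) i =
    \sum_(i < n) \sum_(a < n) (letter i j == a) * f a i.
  rewrite -(big_mkord xpredT (fun i => \sum_(a < n) (letter i j == a) * f a i)).
  rewrite (big_cat_nat (n := height j)) ?height_le //= [X in _ + X]big_nat.
  rewrite [X in _ + X]big1 => [|i /andP[le_hi _]]; last first.
    rewrite big1 // => a _; case: eqP => // eq_a; move: le_hi.
    by rewrite leqNgt height_gt -letter_lt // eq_a ltn_ord.
  rewrite addn0 /index_iota subn0 !big_seq; apply: eq_bigr => i.
  rewrite mem_iota /= add0n height_gt -letter_lt // => lt_l.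
  rewrite (bigD1 (Ordinal lt_l)) //= eqxx mul1n big1 ?addn0 // => a neq_a.
  by case: (letter i j =P a) => // eq_l; case/eqP: neq_a; apply: val_inj.
rewrite (eq_bigr _ (fun j _ => col j)) exchange_big; apply: eq_bigr => i _ /=.
by rewrite exchange_big; apply: eq_bigr => a _ /=; rewrite big_distrl.
Qed.

Lemma count_columns a : a < n ->
  \sum_(j < lam n 0) count_mem a (column j) = \sum_(i < n) multiplicity a i.
Proof.
move=> lt_an; have := sum_columns (fun x _ => x == a).
rewrite (eq_bigr (fun j : 'I__ => count_mem a (column j))) => [->|j _]; last first.
  by rewrite /column count_map -sum1_count [RHS]big_mkcond; apply: eq_bigr => i _ /=; case: eqP.
apply: eq_bigr => i _; rewrite (bigD1 (Ordinal lt_an)) //= eqxx muln1 big1 ?addn0 //.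
move=> b /eqP neq_b; case: (b =P a :> nat) => [eq_b|]; last by rewrite muln0.
by case: neq_b; apply: val_inj.
Qed.

Lemma column_size_count (k : nat -> nat) :
    (forall c, c <= n -> \sum_(i < n) lam c i = \sum_(x < c) k x) ->
  forall a, a < n -> \sum_(j < lam n 0) count_mem a (column j) = k a.
Proof.
move=> size_lam a lt_an; rewrite count_columns //.
have eqc c : c <= n -> \sum_(x < c) \sum_(i < n) multiplicity x i = \sum_(x < c) k x.
  move=> le_cn; rewrite -size_lam // exchange_big; apply: eq_bigr => i _ /=.
  by rewrite multiplicity_sum.
have := eqc _ lt_an; rewrite !big_ord_recr /= (eqc _ (ltnW lt_an)).
exact: addnI.
Qed.
End Tableau.

Import GRing.Theory.
Local Open Scope ring_scope.

(** * Pfaffians *)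

Lemma perm_swapP (T : eqType) (Q : seq T -> Prop) s s' :
    (forall pre x y t, Q (pre ++ x :: y :: t) -> Q (pre ++ y :: x :: t)) ->
  perm_eq s s' -> Q s -> Q s'.
Proof.
move=> Qswap; suff gen pre t t' : perm_eq t t' -> Q (pre ++ t) -> Q (pre ++ t').
  exact: (gen [::]).
elim: t' pre t => [|x t' IH] pre t eqt Qt; first by rewrite -(perm_nilP eqt).
have xt : x \in t by rewrite (perm_mem eqt) mem_head.
case/splitPr: xt eqt Qt => q u eqt Qt.
have {}eqt : perm_eq (q ++ u) t'.
  by rewrite -(perm_cons x); apply: perm_trans eqt; exact: permEl (perm_catCA [:: x] q u).
rewrite -cat_rcons; apply: IH eqt _; rewrite cat_rcons.
elim/last_ind: q u Qt => [|q y IHq] u //.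
by rewrite cat_rcons catA => /Qswap; rewrite -catA => /IHq; rewrite cat_rcons.
Qed.

Section Pfaffian.
Variable R : comNzRingType.
Implicit Types (G : nat -> seq nat -> R) (H : nat -> nat -> seq nat -> R).
Implicit Types (Y : nat -> nat -> R) (s t pre suf : seq nat).

(** The signed sum over all ways of taking one letter out of a sequence. Putting the signs
into the recursion avoids naming positions. *)
Fixpoint del G s : R :=
  if s is x :: s' then G x s' - del (fun y t => G y (x :: t)) s' else 0.

Lemma size_del pre y suf s :
  s = pre ++ y :: suf -> size s = (size (pre ++ suf)).+1.
Proof. by move=> ->; rewrite !size_cat /= addnS. Qed.

Lemma del_closed (Q : R -> Prop) G s :
    Q 0 -> (forall a b, Q a -> Q b -> Q (a - b)) ->
    (forall pre y suf, s = pre ++ y :: suf -> Q (G y (pre ++ suf))) ->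
  Q (del G s).
Proof.
move=> Q0 QB; elim: s G => [|x s IH] G QG //=.
apply: QB; first exact: (QG [::]).
by apply: IH => pre y suf eqs; apply: (QG (x :: pre)); rewrite eqs.
Qed.

Lemma eq_del_in G G' s :
    (forall pre y suf, s = pre ++ y :: suf -> G y (pre ++ suf) = G' y (pre ++ suf)) ->
  del G s = del G' s.
Proof.
elim: s G G' => [|x s IH] G G' eqG //=.
rewrite (eqG [::] x s) //; congr (_ - _); apply: IH => pre y suf eqs.
by apply: (eqG (x :: pre)); rewrite eqs.
Qed.

Lemma eq_del G G' s : (forall y t, G y t = G' y t) -> del G s = del G' s.
Proof. by move=> eqG; apply: eq_del_in. Qed.

Lemma delD G G' s : del (fun y t => G y t + G' y t) s = del G s + del G' s.
Proof.
elim: s G G' => [|x s IH] G G' /=; first by rewrite addr0.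
by rewrite IH; ring.
Qed.

Lemma delZ a G s : del (fun y t => a * G y t) s = a * del G s.
Proof.
elim: s G => [|x s IH] G /=; first by rewrite mulr0.
by rewrite IH; ring.
Qed.

Lemma delN G s : del (fun y t => - G y t) s = - del G s.
Proof.
by rewrite -mulN1r -delZ; apply: eq_del => y t; rewrite mulN1r.
Qed.

Lemma del0 s : del (fun _ _ => 0) s = 0.
Proof. by elim: s => [|x s IH] //=; rewrite IH subr0. Qed.

Lemma del_sum (I : Type) (r : seq I) (P : pred I) (G : I -> nat -> seq nat -> R) s :
  del (fun y t => \sum_(i <- r | P i) G i y t) s = \sum_(i <- r | P i) del (G i) s.
Proof.
elim: r => [|i r IH].
  by rewrite big_nil -[RHS](del0 s); apply: eq_del => y t; rewrite big_nil.
rewrite big_cons -IH; case: (P i) (@big_cons R 0 +%R I i r P) => eqs.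
  by rewrite -delD; apply: eq_del => y t; rewrite eqs.
by apply: eq_del => y t; rewrite eqs.
Qed.

Definition deldel H s := del (fun y t => del (H y) t) s.

Lemma deldel_cons H x s :
  deldel H (x :: s) =
    del (fun y t => H x y t - H y x t) s + deldel (fun y z t => H y z (x :: t)) s.
Proof.
by rewrite /deldel /= !delD !delN; ring.
Qed.

(** Taking out the earlier letter first shifts the position of the later one, which costs
a sign. *)
Lemma deldel_swap H s : deldel H s = - deldel (fun y z => H z y) s.
Proof.
elim: s H => [|x s IH] H; first by rewrite /deldel /= oppr0.
rewrite !deldel_cons IH opprD; congr (_ + _).
by rewrite -delN; apply: eq_del => y t; rewrite opprB.
Qed.

Lemma deldel_sym0 H s : (forall y z t, H y z t = H z y t) -> deldel H s = 0.
Proof.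
elim: s H => [|x s IH] H symH; first by [].
rewrite deldel_cons IH ?addr0 // -[RHS](del0 s).
by apply: eq_del => y t; rewrite symH subrr.
Qed.

Lemma eq_deldel H H' s : (forall y z t, H y z t = H' y z t) -> deldel H s = deldel H' s.
Proof. by move=> eqH; apply: eq_del => y t; apply: eq_del. Qed.

Lemma deldelD H H' s :
  deldel (fun y z t => H y z t + H' y z t) s = deldel H s + deldel H' s.
Proof. by rewrite /deldel -delD; apply: eq_del => y t; rewrite delD. Qed.

Lemma deldelZ a H s : deldel (fun y z t => a * H y z t) s = a * deldel H s.
Proof. by rewrite /deldel -delZ; apply: eq_del => y t; rewrite delZ. Qed.

Fixpoint pf_rec Y k s : R :=
  if s is x :: s' then
    if k is k'.+1 then del (fun y t => Y x y * pf_rec Y k' t) s' else 0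
  else 1.

(** For an alternating [Y], the Pfaffian of the submatrix with rows and columns in [s]; the
recursion is the expansion along the first row. *)
Definition pf Y s := pf_rec Y (size s) s.

Lemma pf_rec_fuel Y k s : (size s <= k)%N -> pf_rec Y k s = pf Y s.
Proof.
rewrite /pf; have [l] := ubnP (size s).
elim: l k s => // l IH [|k] [|x s] //= le_sl le_sk.
apply: eq_del_in => pre y suf eqs.
have := size_del eqs.
by move=> lt_s; rewrite IH ?[in RHS]IH //; lia.
Qed.

Lemma pf_nil Y : pf Y [::] = 1. Proof. by []. Qed.

Lemma pf_cons Y x s : pf Y (x :: s) = del (fun y t => Y x y * pf Y t) s.
Proof.
rewrite {1}/pf /=; apply: eq_del_in => pre y suf eqs.
by rewrite pf_rec_fuel //; have := size_del eqs; lia.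
Qed.

Lemma pf_cons2 Y x y s :
  pf Y (x :: y :: s) =
    Y x y * pf Y s - deldel (fun z w t => Y x z * Y y w * pf Y t) s.
Proof.
rewrite pf_cons /=; congr (_ - _); apply: eq_del => z t.
by rewrite pf_cons -delZ; apply: eq_del => w u; rewrite mulrA.
Qed.

Lemma eq_pf Y Y' s : (forall a b, a \in s -> b \in s -> Y a b = Y' a b) -> pf Y s = pf Y' s.
Proof.
have [l] := ubnP (size s); elim: l s => // l IH [|x s] // le_sl eqY.
rewrite !pf_cons; apply: eq_del_in => pre y suf eqs.
rewrite eqY ?mem_head //; last by rewrite eqs inE mem_cat mem_head !orbT.
congr (_ * _); apply: IH => [|a b a_s b_s].
  by have := size_del eqs; move: le_sl => /=; lia.
have sub c : c \in pre ++ suf -> c \in x :: s.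
  by rewrite inE eqs !mem_cat inE => /orP[] ->; rewrite ?orbT.
by apply: eqY; apply: sub.
Qed.

(** A matrix u v^T - v u^T has rank two, so a Pfaffian is affine in it: the quadratic
terms contain u or v twice and cancel by alternation. *)
Lemma pf_rank2 Y u v s :
  pf (fun a b => Y a b + (u a * v b - v a * u b)) s =
    pf Y s + deldel (fun a b t => u a * v b * pf Y t) s.
Proof.
have [l] := ubnP (size s); elim: l s => // l IH [|x s] le_sl.
  by rewrite /deldel /= addr0.
rewrite pf_cons.
set dd := deldel _ in IH *.
rewrite (@eq_del_in _ (fun y t => (Y x y * pf Y t + Y x y * dd t) +
   ((u x * (v y * pf Y t) - v x * (u y * pf Y t)) +
    (u x * (v y * dd t) - v x * (u y * dd t))))); last first.
  move=> pre y suf eqs; rewrite IH; first by ring.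
  by have := size_del eqs; move: le_sl => /=; lia.
rewrite !delD !delN !delZ /dd deldel_cons -pf_cons -!addrA; congr (_ + _).
have kill w w' : (forall a, w a = w' a) -> del (fun y t => w y *
    deldel (fun a b t => u a * v b * pf Y t) t) s =
    del (fun y t => del (fun z t' => del (fun z' t'' => w' y * (u z * v z' * pf Y t'')) t') t) s.
  move=> eqw; apply: eq_del => y t; rewrite -deldelZ; apply: eq_deldel => a b t'.
  by rewrite eqw.
have kill_u : del (fun y t => u y * deldel (fun a b t => u a * v b * pf Y t) t) s = 0.
  rewrite (kill _ u) //; apply: deldel_sym0 => y z t.
  by apply: eq_del => z' t'; ring.
have kill_v : del (fun y t => v y * deldel (fun a b t => u a * v b * pf Y t) t) s = 0.
  rewrite (kill _ v) //.
  under eq_del => y t do rewrite -[del _ t]/(deldel _ t) deldel_swap /deldel.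
  rewrite delN; apply/eqP; rewrite oppr_eq0; apply/eqP.
  by apply: deldel_sym0 => y z t; apply: eq_del => z' t'; ring.
have rot : del (fun y t => Y x y * deldel (fun a b t => u a * v b * pf Y t) t) s =
           deldel (fun y z t => u y * v z * pf Y (x :: t)) s.
  rewrite (kill _ (Y x)) // -[LHS]/(deldel (fun y z t => _) s) deldel_swap /deldel -delN.
  apply: eq_del => y t; rewrite -[del _ t]/(deldel (fun z z' t' => _) t) deldel_swap opprK.
  apply: eq_del => z t'; rewrite pf_cons -delZ; apply: eq_del => z' t''.
  by ring.
rewrite kill_u kill_v rot.
have -> : del (fun y t => u x * v y * pf Y t - u y * v x * pf Y t) s =
   u x * del (fun y t => v y * pf Y t) s - v x * del (fun y t => u y * pf Y t) s.
  rewrite delD delN -!delZ; congr (_ - _); apply: eq_del => y t; ring.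
by ring.
Qed.

Lemma del_swap G pre x y s :
    (forall pre' w s', (size pre' + size s' < size pre + size s)%N ->
       G w (pre' ++ x :: y :: s') = - G w (pre' ++ y :: x :: s')) ->
  del G (pre ++ x :: y :: s) = - del G (pre ++ y :: x :: s).
Proof.
elim: pre G => [|p pre IH] G altG /=.
  rewrite opprB; set d := del _ s; set d' := del _ s.
  suff -> : d = - d' by ring.
  rewrite /d -delN; apply: eq_del_in => pre w suf eqs.
  by rewrite (altG [::]) //=; have := size_del eqs; lia.
rewrite (altG pre) // (IH (fun y0 t => G y0 (p :: t))); first by ring.
by move=> pre' w s' lt_s; apply: (altG (p :: pre')).
Qed.

Section Alternating.
Variable Y : nat -> nat -> R.
Hypotheses (Yxx : forall a, Y a a = 0) (YC : forall a b, Y a b = - Y b a).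

Lemma pf_swap pre x y s :
  pf Y (pre ++ x :: y :: s) = - pf Y (pre ++ y :: x :: s).
Proof.
have [l] := ubnP (size pre + size s); elim: l pre s => // l IH [|p pre] s le_l /=.
  rewrite !pf_cons2 deldel_swap YC; set d := deldel _ s; set d' := deldel _ s.
  have -> : d = d' by apply: eq_deldel => z w t; ring.
  by ring.
rewrite !pf_cons; apply: del_swap => pre' w s' lt_s.
rewrite IH ?mulrN //; apply: leq_trans lt_s _.
by move: le_l; rewrite /= addSn ltnS => /ltnW.
Qed.

Lemma pf_eq2 x s : pf Y (x :: x :: s) = 0.
Proof.
rewrite pf_cons2 Yxx mul0r deldel_sym0 ?subrr // => y z t.
by congr (_ * _); rewrite mulrC.
Qed.

Lemma pf_move pre x q s :
  pf Y (pre ++ x :: q ++ s) = (-1) ^+ size q * pf Y (pre ++ q ++ x :: s).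
Proof.
elim: q pre => [|p q IH] pre /=; first by rewrite expr0 mul1r.
by rewrite pf_swap -cat_rcons IH cat_rcons exprS mulN1r mulNr.
Qed.

Lemma pf_eq2_cat pre x s : pf Y (pre ++ x :: x :: s) = 0.
Proof.
apply: (can_inj (signrMK (size pre))); rewrite -(pf_move [::]) mulr0 /=.
apply: (can_inj (signrMK (size pre))); rewrite -(pf_move [:: x]) mulr0 /=.
exact: pf_eq2.
Qed.

Lemma pf_not_uniq s : ~~ uniq s -> pf Y s = 0.
Proof.
have dup s0 : ~~ uniq s0 -> exists pre x q suf, s0 = pre ++ x :: q ++ x :: suf.
  elim: s0 => //= x s0 IH; rewrite negb_and negbK => /orP[/splitPr[q suf]|].
    by exists [::], x, q, suf.
  by move=> /IH[pre [y [q [suf ->]]]]; exists (x :: pre), y, q, suf.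
by case/dup=> pre [x [q [suf ->]]]; rewrite pf_move catA pf_eq2_cat mulr0.
Qed.

Lemma pf_perm s s' : perm_eq s s' -> exists b : bool, pf Y s = (-1) ^+ b * pf Y s'.
Proof.
pose Q t := exists b : bool, pf Y s = (-1) ^+ b * pf Y t.
move=> eqs; apply: (@perm_swapP _ Q _ _ _ eqs) => [pre x y t|]; rewrite /Q; first case=> b ->.
  by exists (~~ b); rewrite pf_swap mulrN signrN mulNr.
by exists false; rewrite mul1r.
Qed.

(** The letters 2p and 2p+1 are those which the symplectic form pairs. *)
Definition pair_letters (z : seq nat) := flatten [seq [:: p.*2; p.*2.+1] | p <- z].

Lemma pair_letters_cat z z' : pair_letters (z ++ z') = pair_letters z ++ pair_letters z'.
Proof. by rewrite /pair_letters map_cat flatten_cat. Qed.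

Lemma pf_swap2 pre a b c d s :
  pf Y (pre ++ a :: b :: c :: d :: s) = pf Y (pre ++ c :: d :: a :: b :: s).
Proof.
have := pf_move pre c [:: a; b] (d :: s); rewrite sqrrN expr1n mul1r /= => <-.
by have := pf_move (rcons pre c) d [:: a; b] s; rewrite !cat_rcons sqrrN expr1n mul1r.
Qed.

(** A pair of letters moves past another one without a sign. *)
Lemma pf_perm_pairs pre z z' s :
  perm_eq z z' -> pf Y (pre ++ pair_letters z ++ s) = pf Y (pre ++ pair_letters z' ++ s).
Proof.
pose Q t := pf Y (pre ++ pair_letters z ++ s) = pf Y (pre ++ pair_letters t ++ s).
move=> eqz; apply: (@perm_swapP _ Q _ _ _ eqz) => // pre' x y t; rewrite /Q => ->.
rewrite !pair_letters_cat /= -!catA !(catA pre).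
exact: pf_swap2.
Qed.

End Alternating.
End Pfaffian.

(** * Contracting Pfaffians with the symplectic form *)

Fixpoint words (L : seq nat) m : seq (seq nat) :=
  if m is m'.+1 then [seq p :: z | p <- L, z <- words L m'] else [:: [::]].

Lemma mem_words L m z : (z \in words L m) = (size z == m) && all (mem L) z.
Proof.
elim: m z => [|m IH] [|p z] //=.
- by apply/negP => /allpairsP[[p z] /= []].
apply/allpairsP/andP => [[[q u] /= [qL uW [-> ->]]]|[/eqP[sz] /andP[pL zL]]].
  by move: uW; rewrite IH => /andP[/eqP-> ->]; rewrite andbT; split.
by exists (p, z); split=> //=; rewrite IH zL sz eqxx.
Qed.

Lemma words_uniq L m : uniq L -> uniq (words L m).
Proof.
move=> uL; elim: m => //= m IH; apply: allpairs_uniq => //.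
by move=> [p z] [q u] _ _ [-> ->].
Qed.

Lemma doubleSK p : p.*2.+1./2 = p. Proof. by lia. Qed.

Lemma mem_pair_letters z a : (a \in pair_letters z) = (a./2 \in z).
Proof.
elim: z => //= p z IH; rewrite !inE IH orbA; congr orb.
by apply/idP/idP => [/orP[]/eqP|/eqP]; lia.
Qed.

Lemma pair_letters_uniq z : uniq (pair_letters z) = uniq z.
Proof.
elim: z => //= p z ->; rewrite inE !mem_pair_letters !negb_or.
have [-> ->] : p.*2./2 = p /\ p.*2.+1./2 = p by lia.
by case: (p \in z); rewrite ?andbF //= !andbT; apply/eqP; lia.
Qed.

Section Contraction.
Variables (R : comNzRingType) (I : idealr R) (Y : nat -> nat -> R) (r : nat).
Hypotheses (Yxx : forall a, Y a a = 0) (YC : forall a b, Y a b = - Y b a).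
Variable half : R.
Hypothesis halfE : 2%:R * half = 1.
Hypothesis trI : \sum_(p <- iota 0 r) Y p.*2 p.*2.+1 \in I.
Hypothesis isoI : forall a b,
  \sum_(p <- iota 0 r) (Y p.*2 a * Y p.*2.+1 b - Y p.*2 b * Y p.*2.+1 a) \in I.

(** Expand along the first two rows: the contraction becomes a multiple of the trace,
minus a double sum whose antisymmetrization has the entries of Y^T J Y as coefficients.
The double sum equals its antisymmetrization as soon as 2 is invertible. *)
Lemma contract_head s : \sum_(p <- iota 0 r) pf Y (p.*2 :: p.*2.+1 :: s) \in I.
Proof.
pose H z w t := (\sum_(p <- iota 0 r) Y p.*2 z * Y p.*2.+1 w) * pf Y t.
have -> : \sum_(p <- iota 0 r) pf Y (p.*2 :: p.*2.+1 :: s) =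
   pf Y s * (\sum_(p <- iota 0 r) Y p.*2 p.*2.+1) - deldel H s.
  rewrite mulr_sumr /deldel.
  under [del _ s]eq_del => y t.
    rewrite /H; under eq_del => w u do rewrite mulr_suml.
    rewrite del_sum; over.
  rewrite del_sum -sumrB; apply: eq_bigr => p _.
  by rewrite pf_cons2 mulrC.
have -> : deldel H s = half * deldel (fun z w t => H z w t - H w z t) s.
  have -> : deldel (fun z w t => H z w t - H w z t) s = 2%:R * deldel H s.
    rewrite (deldelD H (fun z w t => - H w z t)).
    rewrite -[deldel (fun z w t => - H w z t) s]opprK -deldel_swap.
    by rewrite mulr_natl mulr2n; congr (_ + _); rewrite /deldel -delN;
       apply: eq_del => y t; rewrite -delN; apply: eq_del => w u; rewrite opprK.
  by rewrite mulrA [half * _]mulrC halfE mul1r.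
rewrite rpredB ?idealMr //.
apply: (@del_closed _ (fun x => x \in I)) => [|a b|pre y suf _]; [exact: rpred0 | exact: rpredB |].
apply: (@del_closed _ (fun x => x \in I)) => [|a b|pre' w suf' _]; [exact: rpred0 | exact: rpredB |].
by rewrite /H -mulrBl -sumrB mulrC idealMr.
Qed.

Lemma pf_pair_head pre a b s : pf Y (pre ++ a :: b :: s) = pf Y (a :: b :: pre ++ s).
Proof.
apply: (can_inj (signrMK (size pre))); rewrite -(pf_move YC [::]) /=.
have /= -> := pf_move YC [:: a] b pre s.
by rewrite signrMK.
Qed.

Lemma contract pre s : \sum_(p <- iota 0 r) pf Y (pre ++ p.*2 :: p.*2.+1 :: s) \in I.
Proof.
under eq_bigr => p _ do rewrite pf_pair_head.
exact: contract_head.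
Qed.

Definition word_sum L m pre s := \sum_(z <- words L m) pf Y (pre ++ pair_letters z ++ s).

Lemma word_sumS L m pre s :
  word_sum L m.+1 pre s = \sum_(p <- L) word_sum L m (pre ++ [:: p.*2; p.*2.+1]) s.
Proof.
rewrite /word_sum /= big_allpairs_dep /=; apply: eq_bigr => p _; apply: eq_bigr => z _.
by rewrite -catA.
Qed.

Lemma word_sum_contract L m pre mid s :
  \sum_(p <- iota 0 r) word_sum L m (pre ++ p.*2 :: p.*2.+1 :: mid) s \in I.
Proof.
rewrite exchange_big; apply: rpred_sum => z _ /=.
under eq_bigr => p _ do rewrite -catA /=.
exact: contract.
Qed.

Variable E : seq nat.
Let E' := [seq p <- iota 0 r | p \notin E].
Hypothesis sE : {subset E <= iota 0 r}.
Hypothesis uE : uniq E.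

Lemma split_iota (f : nat -> R) :
  \sum_(p <- iota 0 r) f p = \sum_(p <- E) f p + \sum_(p <- E') f p.
Proof.
rewrite (bigID (mem E)) /= -big_filter; congr (_ + _); last by rewrite big_filter.
apply/perm_big/uniq_perm; rewrite ?filter_uniq ?iota_uniq // => p.
by rewrite mem_filter; case: (boolP (p \in E)) => // /sE.
Qed.

(** In each place of a word the sum over all pairs is in the ideal, so that summing over
the pairs outside [E] amounts to minus summing over [E]. *)
Lemma word_sum_compl m pre s : word_sum E' m pre s - (-1) ^+ m * word_sum E m pre s \in I.
Proof.
elim: m pre => [|m IH] pre; first by rewrite mul1r subrr rpred0.
rewrite !word_sumS.
have -> : \sum_(p <- E') word_sum E' m (pre ++ [:: p.*2; p.*2.+1]) s -
    (-1) ^+ m.+1 * \sum_(p <- E) word_sum E m (pre ++ [:: p.*2; p.*2.+1]) s =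
  \sum_(p <- E') (word_sum E' m (pre ++ [:: p.*2; p.*2.+1]) s -
     (-1) ^+ m * word_sum E m (pre ++ [:: p.*2; p.*2.+1]) s) +
  (-1) ^+ m * \sum_(p <- iota 0 r) word_sum E m (pre ++ [:: p.*2; p.*2.+1]) s.
  by rewrite sumrB -mulr_sumr split_iota exprS; ring.
rewrite rpredD ?rpred_sum ?idealMr //; exact: word_sum_contract.
Qed.

(** By the pigeonhole principle every Pfaffian in this sum has a repeated letter. *)
Lemma word_sum_long m pre s : (size E < m)%N -> word_sum E m pre s = 0.
Proof.
move=> ltEm; rewrite /word_sum big1_seq // => z /=; rewrite mem_words => /andP[/eqP sz /allP zE].
apply: pf_not_uniq => //; apply: contraL ltEm; rewrite -leqNgt -sz.
rewrite !cat_uniq => /and3P[_ _ /and3P[+ _ _]]; rewrite pair_letters_uniq => uz.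
exact: uniq_leq_size.
Qed.
End Contraction.

(** A measure that drops when letters are replaced with letters of later pairs. *)
Definition coweight r s := (\sum_(a <- s) (r - a./2))%N.

Lemma coweight_pairs r z : coweight r (pair_letters z) = (2 * \sum_(p <- z) (r - p))%N.
Proof.
rewrite /coweight; elim: z => [|p z IH]; first by rewrite !big_nil.
by rewrite /= !big_cons IH; lia.
Qed.

Definition doubles (c : seq nat) i := [seq p <- iota 0 i | (p.*2 \in c) && (p.*2.+1 \in c)].
Definition empties (c : seq nat) i := [seq p <- iota 0 i | (p.*2 \notin c) && (p.*2.+1 \notin c)].

(** Each of the first [i] pairs has 0, 1 or 2 letters in [c]. *)
Lemma count_doubles c i : uniq c ->
  (count (fun a => a < i.*2) c + size (empties c i) = i + size (doubles c i))%N.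
Proof.
move=> uc; rewrite /doubles /empties.
elim: i => [|i IH]; first by rewrite /= (@eq_count _ _ pred0) ?count_pred0.
have -> : (count (fun a => a < i.+1.*2) c =
    count (fun a => a < i.*2) c + count_mem i.*2 c + count_mem i.*2.+1 c)%N.
  elim: c {uc IH} => //= a c ->; move: (count _ c) (count _ c) (count _ c) => x y z.
  by lia.
have -> : iota 0 i.+1 = rcons (iota 0 i) i by rewrite -addn1 iotaD cats1.
rewrite !count_uniq_mem // !filter_rcons.
by case: (i.*2 \in c) IH; case: (i.*2.+1 \in c); rewrite /= ?size_rcons; lia.
Qed.

Section Columns.
Variables (R : comNzRingType) (I : idealr R) (Y : nat -> nat -> R) (r : nat).
Hypotheses (Yxx : forall a, Y a a = 0) (YC : forall a b, Y a b = - Y b a).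
Variable half : R.
Hypothesis halfE : 2%:R * half = 1.
Hypothesis trI : \sum_(p <- iota 0 r) Y p.*2 p.*2.+1 \in I.
Hypothesis isoI : forall a b,
  \sum_(p <- iota 0 r) (Y p.*2 a * Y p.*2.+1 b - Y p.*2 b * Y p.*2.+1 a) \in I.

(** Pairs of [D] that do not occur in [z] have been traded for as many pairs that come
later than all of [D]. *)
Lemma coweight_lt (D z : seq nat) i : (i <= r)%N -> uniq z -> uniq D ->
    {subset D <= iota 0 i} -> (forall p, p \in z -> (p < i)%N -> p \in D) ->
    size z = size D -> ~~ perm_eq z D ->
  (coweight r (pair_letters z) < coweight r (pair_letters D))%N.
Proof.
move=> le_ir uz uD sD zD szD neq.
pose zl := [seq p <- z | (p < i)%N]; pose zh := [seq p <- z | ~~ (p < i)%N].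
pose D' := [seq p <- D | p \notin zl].
have ezl : perm_eq (zl ++ zh) z by rewrite perm_filterC.
have eD : perm_eq (zl ++ D') D.
  apply: perm_trans (permEl (perm_filterC (mem zl) D)); rewrite perm_cat2r.
  apply: uniq_perm; rewrite ?filter_uniq // => p.
  rewrite [in RHS]mem_filter /=; case: (boolP (p \in zl)) => //.
  by rewrite mem_filter => /andP[lt_p /zD ->].
have szh : size zh = size D'.
  move: szD; rewrite -(perm_size ezl) -(perm_size eD) !size_cat.
  exact: addnI.
have D'_gt0 : (0 < size D')%N.
  rewrite lt0n; apply: contra neq => /eqP D'0; apply: perm_trans _ eD.
  have zh0 : zh = [::] by apply: size0nil; rewrite szh.
  by rewrite (size0nil D'0); move: ezl; rewrite zh0 perm_sym.
rewrite !coweight_pairs -(perm_big _ ezl) -(perm_big _ eD) /= !big_cat /= ltn_pmul2l // ltn_add2l.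
have le1 : (\sum_(p <- zh) (r - p) <= size zh * (r - i))%N.
  rewrite -sum1_size big_distrl /= !big_seq; apply: leq_sum => p.
  by rewrite mem_filter => /andP[]; lia.
have le2 : (size D' * (r - i).+1 <= \sum_(p <- D') (r - p))%N.
  rewrite -sum1_size big_distrl /= !big_seq; apply: leq_sum => p.
  by rewrite mem_filter => /andP[_ /sD]; rewrite mem_iota; lia.
by apply: leq_ltn_trans le1 _; apply: leq_trans le2; rewrite szh ltn_pmul2l.
Qed.

(** More than [i] letters of [c] lie in the first [i] pairs, so that among these the set
[D] of pairs contained in [c] is larger than the set [E] of pairs disjoint from [c].
Replace the pairs of [D] by words of the same length [m]: the sum over the words outside
[E] is, modulo the ideal, up to sign the sum over the words in [E], and the latter
vanishes because [E] is too small. The words that permute [D] contribute [m`!] times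
the Pfaffian of [c]. In the other words that avoid [E], and lead to no repeated letter,
some pair comes after the first [i] ones. *)
Lemma column_straighten c i :
    (i <= r)%N -> uniq c -> all (fun a => a < r.*2)%N c ->
    (i < count (fun a => a < i.*2)%N c)%N ->
  exists m (b : bool) zs,
    [/\ (m <= r)%N,
        forall s, s \in zs -> all (fun a => a < r.*2)%N s /\ (coweight r s < coweight r c)%N
      & m`!%:R * pf Y c - (-1) ^+ b * \sum_(s <- zs) pf Y s \in I].
Proof.
move=> le_ir uc c_lt bad.
pose D := doubles c i; pose E := empties c i.
pose rest := [seq a <- c | a./2 \notin D].
have uE : uniq E by rewrite filter_uniq ?iota_uniq.
have uD : uniq D by rewrite filter_uniq ?iota_uniq.
have sE : {subset E <= iota 0 r} by move=> p; rewrite mem_filter !mem_iota; lia.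
have sD : {subset D <= iota 0 i} by move=> p; rewrite mem_filter => /andP[].
pose E' := [seq p <- iota 0 r | p \notin E].
have ltED : (size E < size D)%N by have := count_doubles i uc; rewrite -/D -/E; lia.
have cE : perm_eq c (pair_letters D ++ rest).
  rewrite perm_sym.
  apply: perm_trans (permEl (perm_filterC (fun a => a./2 \in D) c)); rewrite perm_cat2r.
  apply: uniq_perm; rewrite ?filter_uniq ?pair_letters_uniq // => a.
  rewrite mem_filter mem_pair_letters; case: (boolP (a./2 \in D)) => //=.
  rewrite mem_filter => /andP[/andP[c0 c1] _].
  have [->|->] : a = (a./2).*2 \/ a = (a./2).*2.+1 by lia.
    by [].
  by [].
pose m := size D; exists m.
have le_mr : (m <= r)%N.
  by apply: leq_trans le_ir; have := uniq_leq_size uD sD; rewrite size_iota.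
have [b pfc] := pf_perm YC cE.
pose zs := [seq pair_letters z ++ rest |
  z <- words E' m & ~~ perm_eq z D && uniq (pair_letters z ++ rest)].
exists (~~ b), zs; split=> // [_ /mapP[z + ->]|].
  rewrite mem_filter mem_words => /andP[/andP[neq uz] /andP[/eqP sz /allP zE']].
  have zr p : p \in z -> (p < r)%N by move/zE'; rewrite inE mem_filter mem_iota; lia.
  move: uz; rewrite cat_uniq pair_letters_uniq => /and3P[uz /hasPn disj _].
  split.
    apply/allP => a; rewrite mem_cat mem_pair_letters => /orP[/zr|]; first by lia.
    by rewrite mem_filter => /andP[_ /(allP c_lt)].
  rewrite /coweight (perm_big _ cE) /= !big_cat ltn_add2r -!/(coweight _ _).
  (* Among the first [i] pairs, [z] can only use those of [D]. *)
  apply: (coweight_lt le_ir) => // p pz lt_pi.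
  have pE : p \notin E by move/zE': pz; rewrite inE mem_filter => /andP[].
  apply/negPn/negP => pD; move: pE.
  rewrite mem_filter mem_iota /= add0n lt_pi andbT negb_and !negbK => /orP[pc|pc].
    have /disj : p.*2 \in rest by rewrite mem_filter pc andbT doubleK.
    by rewrite /= mem_pair_letters doubleK pz.
  have e2 := doubleSK p.
  have /disj : p.*2.+1 \in rest by rewrite mem_filter pc andbT e2.
  by rewrite /= mem_pair_letters e2 pz.
have := word_sum_compl YC halfE trI isoI sE uE m [::] rest.
have -> : word_sum Y E m [::] rest = 0 by apply: word_sum_long.
rewrite mulr0 subr0 /word_sum (bigID (perm_eq^~ D)) /=.
have -> : \sum_(z <- words E' m | perm_eq z D) pf Y (pair_letters z ++ rest) =
          m`!%:R * pf Y (pair_letters D ++ rest).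
  under eq_bigr => z zD do rewrite (pf_perm_pairs YC [::] _ zD) /=.
  rewrite big_const_seq iter_addr_0 mulr_natl; congr (_ *+ _).
  rewrite -size_filter -(size_permutations uD); apply: perm_size.
  apply: uniq_perm; rewrite ?permutations_uniq ?filter_uniq ?words_uniq ?filter_uniq ?iota_uniq //.
  move=> z; rewrite mem_permutations mem_filter mem_words perm_sym.
  case: (boolP (perm_eq D z)) => //= eqz; rewrite -(perm_size eqz) eqxx /=.
  rewrite -(perm_all _ eqz); apply/allP => p pD; rewrite inE mem_filter.
  move: pD; rewrite !mem_filter !mem_iota; lia.
have -> : \sum_(z <- words E' m | ~~ perm_eq z D) pf Y (pair_letters z ++ rest) =
          \sum_(s <- zs) pf Y s.
  rewrite big_map big_filter big_mkcondr /=; apply: eq_bigr => z _.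
  by case: ifP => // /negbT /(pf_not_uniq Yxx YC).
move=> memI; rewrite pfc signrN mulNr opprK mulrCA -mulrDr.
exact: idealMr.
Qed.
End Columns.

Import Order.TTheory Num.Theory.

(** * Lowest monomials of Pfaffians *)

Section LowestTerm.
Variables (F : fieldType) (N : nat) (w : 'I_N -> nat).
Local Notation D := {mpoly F[N]}.
Implicit Types (p q : D) (m : 'X_{1..N}) (k l : int).

Definition wt m : int := (\sum_(i < N) m i * w i)%N%:Z.

Lemma wtD m m' : wt (m + m')%MM = wt m + wt m'.
Proof.
rewrite /wt -PoszD -big_split; congr Posz; apply: eq_bigr => i _.
by rewrite mnmDE mulnDl.
Qed.

Lemma wt0 : wt 0%MM = 0.
Proof. by rewrite /wt big1 // => i _; rewrite mnm0E. Qed.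

Lemma wtU i : wt U_(i)%MM = (w i)%:Z.
Proof.
rewrite /wt (bigD1 i) //= mnm1E eqxx mul1n big1 ?addn0 // => j /negPf ji.
by rewrite mnm1E eq_sym ji.
Qed.

Definition wt_ge k p := forall m, m \in msupp p -> k <= wt m.

Lemma wt_ge_weak k l p : l <= k -> wt_ge k p -> wt_ge l p.
Proof. by move=> le_lk kp m /kp; apply: le_trans. Qed.

Lemma wt_ge0 k : wt_ge k 0.
Proof. by move=> m; rewrite msupp0. Qed.

Lemma wt_geD k p q : wt_ge k p -> wt_ge k q -> wt_ge k (p + q).
Proof. by move=> kp kq m /msuppD_le; rewrite mem_cat => /orP[/kp|/kq]. Qed.

Lemma wt_geB k p q : wt_ge k p -> wt_ge k q -> wt_ge k (p - q).
Proof. by move=> kp kq m /msuppB_le; rewrite mem_cat => /orP[/kp|/kq]. Qed.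

Lemma wt_geM k l p q : wt_ge k p -> wt_ge l q -> wt_ge (k + l) (p * q).
Proof.
move=> kp lq m /msuppM_le /allpairsP[[m1 m2] /= [m1p m2q ->]].
by rewrite wtD lerD ?kp ?lq.
Qed.

Lemma wt_geZ k c p : wt_ge k p -> wt_ge k (c *: p).
Proof. by move=> kp m /msuppZ_le /kp. Qed.

Lemma wt_geX m : wt_ge (wt m) 'X_[m].
Proof. by move=> m'; rewrite msuppX inE => /eqP->. Qed.

Lemma wt_ge_nonneg k p : k <= 0 -> wt_ge k p.
Proof. by move=> le_k0 m _; apply: le_trans le_k0 _. Qed.

(** The monomial [m] is the only one of least weight in [p]. It is split off explicitly in
order to make products easy. *)
Definition lowest p m :=
  exists c q, [/\ c != 0, p = c *: 'X_[m] + q & wt_ge (wt m + 1) q].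

Lemma lowest_ge p m : lowest p m -> wt_ge (wt m) p.
Proof.
case=> c [q [_ -> qm]]; apply: wt_geD; first exact/wt_geZ/wt_geX.
by apply: wt_ge_weak qm; rewrite lerDl.
Qed.

Lemma lowestX m : lowest 'X_[m] m.
Proof.
exists 1, 0; split; [exact: oner_neq0 | by rewrite scale1r addr0 | exact: wt_ge0].
Qed.

Lemma lowest1 : lowest 1 0%MM.
Proof. by rewrite -mpolyX0; apply: lowestX. Qed.

Lemma lowest_add p q m : lowest p m -> wt_ge (wt m + 1) q -> lowest (p + q) m.
Proof.
case=> c [p' [c0 -> p'm]] qm; exists c, (p' + q); split=> //; first by rewrite addrA.
exact: wt_geD.
Qed.

Lemma lowest_sub p q m : lowest p m -> wt_ge (wt m + 1) q -> lowest (p - q) m.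
Proof.
by move=> pm qm; apply: lowest_add => //; rewrite -scaleN1r; apply: wt_geZ.
Qed.

Lemma lowestM p q m m' : lowest p m -> lowest q m' -> lowest (p * q) (m + m')%MM.
Proof.
case=> c [p' [c0 -> p'm]] qm'; have qge := lowest_ge qm'.
case: qm' qge => d [q' [d0 eq_q q'm]] qge.
exists (c * d), (c *: 'X_[m] * q' + p' * q); split; first by rewrite mulf_neq0.
  rewrite mulrDl {1}eq_q mulrDr -!scalerAl -scalerAr scalerA mpolyXD addrA.
  by congr (_ + _ + _).
apply: wt_geD.
  rewrite wtD -addrA; apply: wt_geM => //; exact/wt_geZ/wt_geX.
by rewrite wtD addrAC; apply: wt_geM.
Qed.

Lemma lowest_prod (J : Type) (s : seq J) (p : J -> D) (m : J -> 'X_{1..N}) :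
  (forall j, lowest (p j) (m j)) ->
  lowest (\prod_(j <- s) p j) (\big[mnm_add/0%MM]_(j <- s) m j).
Proof.
move=> pm; elim: s => [|j s IH]; first by rewrite !big_nil; apply: lowest1.
by rewrite !big_cons; apply: lowestM.
Qed.

(** In a linear relation, the lowest monomial of least weight among those that occur with
a nonzero coefficient cannot be cancelled. *)
Lemma lowest_free (J : eqType) (s : seq J) (a : J -> F) (p : J -> D) (m : J -> 'X_{1..N}) :
    {in s, forall j, lowest (p j) (m j)} -> {in s &, injective m} -> uniq s ->
    \sum_(j <- s) a j *: p j = 0 ->
  {in s, forall j, a j = 0}.
Proof.
move=> pm m_inj us sum0 j js; apply/eqP/negPn/negP => aj.
have [l] := ubnP (absz (wt (m j))); elim: l j js aj => // l IH j js aj le_l.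
have min j' : j' \in s -> a j' != 0 -> wt (m j) <= wt (m j').
  move=> j's aj'; rewrite leNgt; apply/negP => lt_j; apply: (IH j') => //.
  by move: lt_j le_l; rewrite /wt; lia.
have /eqP := congr1 (mcoeff (m j)) sum0; rewrite raddf_sum mcoeff0 /= (bigD1_seq j) //=.
rewrite big1_seq ?addr0 => [|j' /andP[neq j's]].
  have [c [q [c0 -> qm]]] := pm _ js.
  rewrite mcoeffZ mcoeffD mcoeffZ mcoeffX eqxx mulr1 memN_msupp_eq0 ?addr0.
    by rewrite mulf_eq0 (negPf aj) (negPf c0).
  by apply/negP => /qm; lia.
have [->|aj'] := eqVneq (a j') 0; first by rewrite scale0r mcoeff0.
have [c [q [c0 -> qm]]] := pm _ j's.
rewrite mcoeffZ mcoeffD mcoeffZ mcoeffX.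
have /negPf -> : m j' != m j by apply: contra neq => /eqP /m_inj ->.
rewrite mulr0 add0r memN_msupp_eq0 ?mulr0 //.
by apply/negP => /qm; have := min _ j's aj'; lia.
Qed.

(** The weight [om a i] bounds that of the entry (a, i) of a frame from below. Strict
submodularity makes the increasing assignment of columns to letters the cheapest one. *)
Variables (n : nat) (om : nat -> nat -> int).
Hypothesis om_sub : forall a b i j, (a < b)%N -> (b < n)%N -> (i < j)%N ->
  om a i + om b j < om a j + om b i.
Hypothesis om_incr : forall a i, (a < n)%N -> om a i < om a i.+1.

Fixpoint column_wt i (s : seq nat) : int := if s is a :: s' then om a i + column_wt i.+1 s' else 0.

Local Notation is_column s := (sorted ltn s && all (fun a => a < n)%N s).

Lemma sorted_cons a s : is_column (a :: s) -> is_column s.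
Proof. by case/andP=> /= /path_sorted -> /andP[_ ->]. Qed.

Lemma sorted_lt x pre y suf : is_column (x :: pre ++ y :: suf) -> (x < y < n)%N.
Proof.
case/andP => /= srt /andP[_]; rewrite all_cat /= => /and3P[_ -> _]; rewrite andbT.
move: srt; rewrite path_sortedE; last exact: ltn_trans.
by rewrite all_cat /= => /andP[/and3P[]].
Qed.

Lemma sorted_del pre y suf : is_column (pre ++ y :: suf) -> is_column (pre ++ suf).
Proof.
case/andP=> srt ltn_s; apply/andP; split.
  apply: subseq_sorted srt; first exact: ltn_trans.
  by rewrite cat_subseq // subseq_cons.
by move: ltn_s; rewrite !all_cat /= => /and3P[-> _ ->].
Qed.

(** Strict submodularity of the weights: giving the first free column of the frame to a
letter other than the first one is not cheaper. *)
Lemma column_wt_del i pre y suf : is_column (pre ++ y :: suf) ->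
  column_wt i (pre ++ y :: suf) <= om y i + column_wt i.+1 (pre ++ suf).
Proof.
elim: pre i => [|x pre IH] i //= srt.
have /andP[lt_xy lt_yn] := sorted_lt srt.
have := IH i.+1 (sorted_cons srt); have := om_sub lt_xy lt_yn (ltnSn i); lia.
Qed.

Lemma column_wt_del_lt i x pre y suf : is_column (x :: pre ++ y :: suf) ->
  column_wt i (x :: pre ++ y :: suf) + 1 <= om y i + column_wt i.+1 (x :: pre ++ suf).
Proof.
move=> srt /=.
have /andP[lt_xy lt_yn] := sorted_lt srt.
have := column_wt_del i.+1 (sorted_cons srt); have := om_sub lt_xy lt_yn (ltnSn i); lia.
Qed.

Lemma column_wt_incr i s : all (fun a => a < n)%N s -> column_wt i s <= column_wt i.+1 s.
Proof. by elim: s i => //= a s IH i /andP[/(om_incr i) + /(IH i.+1)]; lia. Qed.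

Section Deletion.
Variables (i : nat) (G : nat -> seq nat -> D) (s : seq nat).
Hypothesis srt : is_column s.
Hypothesis Gge : forall pre y suf, s = pre ++ y :: suf ->
  wt_ge (om y i + column_wt i.+1 (pre ++ suf)) (G y (pre ++ suf)).

Lemma del_ge : wt_ge (column_wt i s) (del G s).
Proof.
apply: (@del_closed _ (wt_ge _)) => [|p q|pre y suf eqs].
- exact: wt_ge0.
- exact: wt_geB.
by apply: wt_ge_weak (Gge eqs); rewrite {1}eqs column_wt_del // -eqs.
Qed.

Lemma del_lowest x t m : s = x :: t -> lowest (G x t) m -> wt m = column_wt i s ->
  lowest (del G s) m.
Proof.
move=> eqs Gm eq_m; rewrite eqs /=; apply: lowest_sub => //; rewrite eq_m.
apply: (@del_closed _ (wt_ge _)) => [|p q|pre y suf eqt].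
- exact: wt_ge0.
- exact: wt_geB.
have eqs' : s = (x :: pre) ++ y :: suf by rewrite eqs eqt.
apply: wt_ge_weak (Gge eqs').
by rewrite {1}eqs'; apply: column_wt_del_lt; move: srt; rewrite eqs'.
Qed.
End Deletion.

Variables (c : nat -> nat -> D) (mon : nat -> nat -> 'X_{1..N}) (allowed : nat -> nat -> bool).
Hypothesis c_ge : forall a i, (a < n)%N -> wt_ge (om a i) (c a i).
Hypothesis c_low : forall a i, (a < n)%N -> allowed a i ->
  lowest (c a i) (mon a i) /\ wt (mon a i) = om a i.

(** The entries of C Omega C^T, where only [d] pairs of columns of C are used, starting
with the columns 2k and 2k+1. *)
Fixpoint blocks (d k a b : nat) : D :=
  if d is d'.+1 then
    blocks d' k.+1 a b + (c a k.*2 * c b k.*2.+1 - c a k.*2.+1 * c b k.*2)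
  else 0.

Lemma pf_blocksS d (k : nat) s : pf (blocks d.+1 k) s = pf (blocks d k.+1) s +
  deldel (fun a b t => c a k.*2 * c b k.*2.+1 * pf (blocks d k.+1) t) s.
Proof. exact: (pf_rank2 _ (c^~ k.*2) (c^~ k.*2.+1)). Qed.

Lemma pf_blocks0 (k : nat) x s : pf (blocks 0 k) (x :: s) = 0.
Proof.
rewrite pf_cons -[RHS](del0 _ s); apply: eq_del => y t.
by rewrite /= mul0r.
Qed.

Fixpoint column_mon i s : 'X_{1..N} :=
  if s is a :: s' then (mon a i + column_mon i.+1 s')%MM else 0%MM.

Fixpoint column_allowed i s := if s is a :: s' then allowed a i && column_allowed i.+1 s' else true.

Lemma wt_column_mon i s : all (fun a => a < n)%N s -> column_allowed i s ->
  wt (column_mon i s) = column_wt i s.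
Proof.
elim: s i => [|a s IH] i /=; first by rewrite wt0.
by move=> /andP[lt_a ltn_s] /andP[al als]; rewrite wtD IH // (c_low lt_a al).2.
Qed.

Lemma mem_sorted_lt a s : is_column s -> a \in s -> (a < n)%N.
Proof. by case/andP=> _ /allP; apply. Qed.

Section Block.
Variables (k : nat) (P : seq nat -> D).
Hypothesis P_ge : forall s, is_column s -> wt_ge (column_wt k.+2 s) (P s).

Let G y t := del (fun z u => c y k * c z k.+1 * P u) t.

Lemma block_row_ge y t : (y < n)%N -> is_column t -> wt_ge (om y k + column_wt k.+1 t) (G y t).
Proof.
move=> lt_y srt; rewrite /G; under eq_del => z u do rewrite -mulrA.
rewrite delZ; apply: wt_geM; first exact: c_ge.
apply: del_ge => // pre z suf eqt; apply: wt_geM.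
  by apply/c_ge/(mem_sorted_lt srt); rewrite eqt mem_cat mem_head orbT.
by apply: P_ge; apply: (@sorted_del _ z); rewrite -eqt.
Qed.

Lemma block_ge s : is_column s -> wt_ge (column_wt k s) (del G s).
Proof.
move=> srt; apply: del_ge => // pre y suf eqs; apply: block_row_ge.
  by apply: (mem_sorted_lt srt); rewrite eqs mem_cat mem_head orbT.
by apply: (@sorted_del _ y); rewrite -eqs.
Qed.

Lemma block_lowest x y s : is_column [:: x, y & s] -> allowed x k -> allowed y k.+1 ->
    lowest (P s) (column_mon k.+2 s) -> wt (column_mon k.+2 s) = column_wt k.+2 s ->
  lowest (del G [:: x, y & s]) (column_mon k [:: x, y & s]).
Proof.
move=> srt alx aly Ps wPs.
have lt_x : (x < n)%N by apply: mem_sorted_lt srt (mem_head _ _).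
have lt_y : (y < n)%N by apply: (mem_sorted_lt srt); rewrite !inE eqxx orbT.
have [cx wx] := c_low lt_x alx; have [cy wy] := c_low lt_y aly.
apply: (@del_lowest k _ _ srt _ x (y :: s)) => //.
- move=> pre z suf eqs; apply: block_row_ge.
    by apply: (mem_sorted_lt srt); rewrite eqs mem_cat mem_head orbT.
  by apply: (@sorted_del _ z); rewrite -eqs.
- rewrite /G; under eq_del => z u do rewrite -mulrA.
  rewrite delZ [column_mon k _]/=; apply: lowestM => //.
  have srt' := sorted_cons srt.
  apply: (@del_lowest k.+1 _ _ srt' _ y s) => //.
  + move=> pre z suf eqs; apply: wt_geM.
      by apply/c_ge/(mem_sorted_lt srt'); rewrite eqs mem_cat mem_head orbT.
    by apply: P_ge; apply: (@sorted_del _ z); rewrite -eqs.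
  + exact: lowestM.
  + by rewrite wtD wPs wy.
by rewrite /= !wtD wPs wx wy.
Qed.
End Block.

Lemma pf_blocks_ge d (k : nat) s : is_column s -> wt_ge (column_wt k.*2 s) (pf (blocks d k) s).
Proof.
elim: d k s => [|d IH] k [|x s] srt; try by apply: wt_ge_nonneg.
  by rewrite pf_blocks0; apply: wt_ge0.
rewrite pf_blocksS; apply: wt_geD; last first.
  by apply: block_ge srt => t srt_t; rewrite -doubleS; apply: IH.
apply: wt_ge_weak (IH k.+1 _ srt); have /andP[_ ltn_s] := srt.
by apply: le_trans (column_wt_incr _ ltn_s) _; rewrite doubleS; apply: column_wt_incr.
Qed.

(** Peel off the first pair of columns by a rank two update. By submodularity it is
cheapest to give these two columns to the two smallest letters; not to use them at all
costs more, because weights increase with the column. *)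
Lemma pf_blocks_lowest d (k : nat) s : is_column s -> ~~ odd (size s) -> (size s <= d.*2)%N ->
  column_allowed k.*2 s -> lowest (pf (blocks d k) s) (column_mon k.*2 s).
Proof.
elim: d k s => [|d IH] k [|x [|y s]] // srt; try by move=> *; apply: lowest1.
move=> even_s size_s al.
have ltn_s : all (fun a => a < n)%N [:: x, y & s] by have /andP[] := srt.
rewrite pf_blocksS addrC; apply: lowest_add; last first.
  rewrite wt_column_mon //; apply: wt_ge_weak (@pf_blocks_ge d k.+1 _ srt).
  have le1 := column_wt_incr k.*2.+1 ltn_s; rewrite doubleS; apply: le_trans le1.
  case/andP: ltn_s => lt_x ltn_s; have := om_incr k.*2 lt_x.
  have /= := @column_wt_incr k.*2.+1 (y :: s) ltn_s; lia.
move: al => /= /and3P[alx aly als].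
apply: block_lowest => //.
- by move=> t srt_t; rewrite -doubleS; apply: pf_blocks_ge.
- rewrite -doubleS; apply: IH => //; first exact/(sorted_cons (sorted_cons srt)).
  by move: even_s; rewrite /= negbK.
- by apply: wt_column_mon => //; case/and3P: ltn_s.
Qed.
End LowestTerm.

(** * Linear spans *)

Section Span.
Variables (F : fieldType) (V : lmodType F).
Implicit Types (S : V -> Prop) (u v : V).

Inductive spanned S : V -> Prop :=
| spanned0 : spanned S 0
| spanned_cons a v u : S v -> spanned S u -> spanned S (a *: v + u).

Lemma spannedD S u v : spanned S u -> spanned S v -> spanned S (u + v).
Proof.
move=> Su Sv; elim: Su => [|a w u' Sw _ IH]; first by rewrite add0r.
by rewrite -addrA; apply: spanned_cons.
Qed.

Lemma spannedZ S a u : spanned S u -> spanned S (a *: u).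
Proof.
elim=> [|b w u' Sw _ IH]; first by rewrite scaler0; apply: spanned0.
by rewrite scalerDr scalerA; apply: spanned_cons.
Qed.

Lemma spannedN S u : spanned S u -> spanned S (- u).
Proof. by rewrite -scaleN1r; apply: spannedZ. Qed.

Lemma spannedB S u v : spanned S u -> spanned S v -> spanned S (u - v).
Proof. by move=> Su /spannedN; apply: spannedD. Qed.

Lemma spanned_in S u : S u -> spanned S u.
Proof.
move=> Su; rewrite -[u]addr0 -[u in X in spanned S X]scale1r.
by apply: spanned_cons => //; apply: spanned0.
Qed.

Lemma spanned_sub S S' u : (forall v, S v -> spanned S' v) -> spanned S u -> spanned S' u.
Proof.
move=> sub; elim=> [|a w u' Sw _ IH]; first exact: spanned0.
by apply: spannedD => //; apply/spannedZ/sub.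
Qed.

Lemma spanned_sum S (J : Type) (s : seq J) (f : J -> V) :
  (forall j, spanned S (f j)) -> spanned S (\sum_(j <- s) f j).
Proof.
move=> Sf; elim: s => [|j s IH]; first by rewrite big_nil; apply: spanned0.
by rewrite big_cons; apply: spannedD.
Qed.

Lemma spanned_family (J : finType) (e : J -> V) u :
  spanned (fun v => exists j, v = e j) u -> exists c : J -> F, u = \sum_j c j *: e j.
Proof.
elim=> [|a _ u' [j ->] _ [c ->]].
  by exists (fun=> 0); rewrite big1 // => j _; rewrite scale0r.
exists (fun i => (if i == j then a else 0) + c i).
rewrite -[a *: e j](_ : \sum_i (if i == j then a else 0) *: e i = _); last first.
  rewrite (bigD1 j) //= eqxx big1 ?addr0 // => i /negPf ->.
  by rewrite scale0r.
by rewrite -big_split; apply: eq_bigr => i _; rewrite scalerDl.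
Qed.

(** The coefficients of the independent family form a matrix with independent rows, which
is square for reasons of size, hence invertible. *)
Lemma spanned_exchange (I J : finType) (e : I -> V) (g : J -> V) :
    (#|I| <= #|J|)%N -> (forall j, spanned (fun v => exists i, v = e i) (g j)) ->
    (forall a : J -> F, \sum_j a j *: g j = 0 -> forall j, a j = 0) ->
  forall i, spanned (fun v => exists j, v = g j) (e i).
Proof.
move=> leIJ ge g_free.
have /choice[c gE] j := spanned_family (ge j).
pose M := \matrix_(j < #|J|, i < #|I|) c (enum_val j) (enum_val i).
have sumE (v : 'rV_#|J|) : \sum_j v 0 (enum_rank j) *: g j =
    \sum_i (v *m M) 0 (enum_rank i) *: e i.
  under eq_bigr => j _ do rewrite gE scaler_sumr.
  rewrite exchange_big; apply: eq_bigr => i _ /=.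
  rewrite mxE scaler_suml [LHS](reindex (fun i : 'I_#|J| => enum_val i)) /=; last first.
    exact/onW_bij/enum_val_bij.
  apply: eq_bigr => j _; rewrite !mxE enum_valK enum_rankK scalerA.
  by [].
have freeM : row_free M.
  apply: inj_row_free => v vM0; apply/rowP => j; rewrite mxE.
  have := g_free (fun j => v 0 (enum_rank j)); rewrite sumE vM0.
  rewrite big1 => [/(_ erefl (enum_val j))|i _]; first by rewrite enum_valK.
  by rewrite mxE scale0r.
have fullM : row_full M.
  by rewrite /row_full eqn_leq rank_leq_col (eqP freeM).
have /row_fullP[B BM1] := fullM.
move=> i; have -> : e i = \sum_j (row (enum_rank i) B) 0 (enum_rank j) *: g j.
  rewrite sumE -row_mul BM1 (bigD1 i) //= big1 ?addr0 => [|i' /negPf neq].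
    by rewrite !mxE eqxx scale1r.
  rewrite !mxE; case: eqP => [/enum_rank_inj eq_i|]; last by rewrite scale0r.
  by rewrite eq_i eqxx in neq.
by apply: spanned_sum => j; apply/spannedZ/spanned_in; exists j.
Qed.
End Span.

(** * The basis of tableau products *)

Section Contents.
Variables (F : fieldType) (P : comAlgType F) (n : nat) (y : nat -> nat -> P).
Hypotheses (yxx : forall a, y a a = 0) (yC : forall a b, y a b = - y b a).

Definition entry_mon (m : nat -> nat -> nat) : P :=
  \prod_(b < n) \prod_(a < b) y a b ^+ m a b.

Definition has_content (k : nat -> nat) (v : P) :=
  exists m, (forall x, (x < n)%N -> letter_count m n x = k x) /\ v = entry_mon m.

Lemma letter_countD m m' x :
  letter_count (fun a b => m a b + m' a b)%N n x = (letter_count m n x + letter_count m' n x)%N.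
Proof.
rewrite /letter_count -big_split; apply: eq_bigr => b _ /=.
by rewrite -big_split; apply: eq_bigr => a _ /=; rewrite mulnDl.
Qed.

Lemma entry_monD m m' : entry_mon (fun a b => m a b + m' a b)%N = entry_mon m * entry_mon m'.
Proof.
rewrite /entry_mon -big_split; apply: eq_bigr => b _ /=.
by rewrite -big_split; apply: eq_bigr => a _ /=; rewrite exprD.
Qed.

Lemma spanned_content_eq k k' p : (forall x, (x < n)%N -> k x = k' x) ->
  spanned (has_content k) p -> spanned (has_content k') p.
Proof.
move=> eqk; apply: spanned_sub => v [m [eqm ->]]; apply: spanned_in; exists m.
by split=> // x lt_x; rewrite eqm // eqk.
Qed.

Lemma spanned_contentM k k' k'' p q : (forall x, (x < n)%N -> k'' x = k x + k' x)%N ->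
  spanned (has_content k) p -> spanned (has_content k') q -> spanned (has_content k'') (p * q).
Proof.
move=> eqk kp kq; elim: kp => [|a _ u [m [eqm ->]] _ IH]; first by rewrite mul0r; apply: spanned0.
rewrite mulrDl -scalerAl; apply: spannedD IH; apply: spannedZ.
elim: kq => [|b _ v [m' [eqm' ->]] _ IH]; first by rewrite mulr0; apply: spanned0.
rewrite mulrDr -scalerAr; apply: spannedD IH; apply/spannedZ/spanned_in.
exists (fun a b => m a b + m' a b)%N; split; last by rewrite entry_monD.
by move=> x lt_x; rewrite letter_countD eqm // eqm' // eqk.
Qed.

Lemma spanned_content1 : spanned (has_content (fun=> 0%N)) 1.
Proof.
apply: spanned_in; exists (fun _ _ => 0%N); split.
  by move=> x _; rewrite /letter_count big1 // => b _; rewrite big1.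
by rewrite /entry_mon big1 // => b _; rewrite big1 // => a _; rewrite expr0.
Qed.

Lemma spanned_content_y a b : (a < n)%N -> (b < n)%N ->
  spanned (has_content (fun x => (a == x) + (b == x))%N) (y a b).
Proof.
move=> lt_a lt_b.
have up a0 b0 : (a0 < b0)%N -> (b0 < n)%N ->
    spanned (has_content (fun x => (a0 == x) + (b0 == x))%N) (y a0 b0).
  move=> lt_ab lt_bn; apply: spanned_in.
  exists (fun a' b' => ((a' == a0) && (b' == b0)) : nat); split.
    move=> x _; rewrite /letter_count (bigD1 (Ordinal lt_bn)) //=.
    rewrite (bigD1 (Ordinal lt_ab)) //= !eqxx mul1n.
    rewrite big1 => [|a' neq]; last first.
      by rewrite andbT -[a' == a0 :> nat]/(a' == Ordinal lt_ab) (negPf neq).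
    rewrite big1 ?addn0 // => b' neq; rewrite big1 // => a' _.
    by rewrite -[b' == b0 :> nat]/(b' == Ordinal lt_bn) (negPf neq) andbF.
  rewrite /entry_mon (bigD1 (Ordinal lt_bn)) //= (bigD1 (Ordinal lt_ab)) //= !eqxx expr1.
  rewrite big1 => [|a' neq]; last first.
    by rewrite andbT -[a' == a0 :> nat]/(a' == Ordinal lt_ab) (negPf neq) expr0.
  rewrite big1 ?mulr1 // => b' neq; rewrite big1 // => a' _.
  by rewrite -[b' == b0 :> nat]/(b' == Ordinal lt_bn) (negPf neq) andbF expr0.
case: (ssrnat.ltngtP a b) => [lt_ab|lt_ba|->]; first exact: up.
  rewrite yC; apply: spannedN; apply: spanned_content_eq (up _ _ lt_ba lt_a) => x _.
  by rewrite addnC.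
by rewrite yxx; apply: spanned0.
Qed.

Lemma spanned_content_pf s : all (fun a => a < n)%N s ->
  spanned (has_content (fun x => count_mem x s)) (pf y s).
Proof.
have [l] := ubnP (size s); elim: l s => // l IH [|x s].
  by move=> _ _; apply: spanned_content1.
move=> lt_s /= /andP[lt_x ltn_s]; rewrite pf_cons.
apply: (@del_closed _ (spanned _)) => [|p q|pre z suf eqs].
- exact: spanned0.
- exact: spannedB.
have eqp : perm_eq s (z :: pre ++ suf) by rewrite eqs -[z :: _]cat1s perm_catCA.
move: ltn_s; rewrite (perm_all _ eqp) /= => /andP[lt_z ltn_t].
apply: spanned_contentM (spanned_content_y lt_x lt_z) (IH _ _ ltn_t).
  by move=> a _; rewrite (permP eqp) /= addnA.
by have := size_del eqs; move: lt_s => /=; lia.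
Qed.

Lemma spanned_content_prod (J : Type) (r : seq J) (cols : J -> seq nat) :
  (forall j, all (fun a => a < n)%N (cols j)) ->
  spanned (has_content (fun x => \sum_(j <- r) count_mem x (cols j))%N)
       (\prod_(j <- r) pf y (cols j)).
Proof.
move=> lt_c; elim: r => [|j r IH].
  rewrite big_nil; apply: spanned_content_eq spanned_content1 => x _.
  by rewrite big_nil.
rewrite big_cons; apply: spanned_contentM (spanned_content_pf (lt_c j)) IH => x _.
by rewrite big_cons.
Qed.

Definition std_product (lam : nat -> nat -> nat) : P := \prod_(j < lam n 0%N) pf y (column lam n j).

Definition std_pattern lam := gt_pattern lam /\ even_shape (lam n).

Definition pattern_content (k : nat -> nat) (lam : nat -> nat -> nat) :=
  forall c, (c <= n)%N -> (\sum_(i < n) lam c i = \sum_(x < c) k x)%N.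

Lemma spanned_content_std k lam : std_pattern lam -> pattern_content k lam ->
  spanned (has_content k) (std_product lam).
Proof.
move=> [gt even] size_lam; rewrite /std_product.
have := @spanned_content_prod _ (index_enum 'I_(lam n 0%N)) (fun j => column lam n j)
  (fun j => column_letter_lt n gt j).
apply: spanned_content_eq => x lt_x.
by rewrite (column_size_count gt size_lam).
Qed.

Hypothesis std_free : forall (J : finType) (lam : J -> nat -> nat -> nat) (a : J -> F),
  (forall j, std_pattern (lam j)) ->
  (forall i j, (forall c x, (c <= n)%N -> (x < n)%N -> lam i c x = lam j c x) -> i = j) ->
  \sum_j a j *: std_product (lam j) = 0 -> forall j, a j = 0.

Lemma content_bound m k a b : (forall x, (x < n)%N -> letter_count m n x = k x) ->
  (a < b)%N -> (b < n)%N -> (m a b <= \sum_(x < n) k x)%N.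
Proof.
move=> eqm lt_ab lt_bn; apply: (@leq_trans (k b)).
  rewrite -eqm // /letter_count (bigD1 (Ordinal lt_bn)) //= (bigD1 (Ordinal lt_ab)) //=.
  by rewrite eqxx; lia.
by rewrite (bigD1 (Ordinal lt_bn)) //= leq_addr.
Qed.

Hypothesis n_even : ~~ odd n.

(** The products of standard tableaux are linearly independent, and by row insertion there
are at least as many of them as there are monomials of the same content. *)
Lemma has_content_std k v : has_content k v ->
  spanned (fun u => exists lam, [/\ std_pattern lam, pattern_content k lam & u = std_product lam]) v.
Proof.
pose B := (\sum_(x < n) k x).+1.
(* Exponents and patterns of content [k], as elements of finite types. *)
pose mof (f : {ffun 'I_n * 'I_n -> 'I_B}) a b : nat :=
  if insub a is Some i then if insub b is Some j then f (i, j) else 0%N else 0%N.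
have mofE f (i j : 'I_n) : mof f i j = f (i, j) by rewrite /mof !valK.
pose lamof (g : {ffun 'I_n.+1 * 'I_n -> 'I_B}) c x : nat :=
  if insub x is Some i then g (inord (minn c n), i) else 0%N.
pose condI f := `[< (forall x, (x < n)%N -> letter_count (mof f) n x = k x) /\
  forall i j : 'I_n, ~~ (i < j)%N -> f (i, j) = ord0 >].
pose condJ g := `[< std_pattern (lamof g) /\ pattern_content k (lamof g) >].
pose I := {f | condI f}; pose J := {g | condJ g}.
(* Row insertion, as a map between finite types. *)
have rskP (f : I) : exists g : J, forall c x, lamof (val g) c x = rsk (mof (val f)) n (minn c n) x.
  case: f => f /= /asboolP[eqf _]; set R := rsk _ n.
  have [gtR evenR] : gt_pattern R /\ even_shape (R n) by apply: rsk_gt_even.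
  have sizeR c : (c <= n)%N -> (\sum_(i < n) R c i = \sum_(x < c) k x)%N.
    move=> le_cn; rewrite (rsk_size_even (mof f)) //.
    by apply: eq_bigr => x _; rewrite eqf // (leq_trans (ltn_ord x)).
  have zeroR c x : (n <= x)%N -> R (minn c n) x = 0%N.
    by move=> le_nx; apply: (gt_pattern_zero gtR); apply: leq_trans (geq_minr c n) le_nx.
  have ltR c x : (R (minn c n) x < B)%N.
    case: (ltnP x n) => [lt_xn|le_nx]; last by rewrite zeroR.
    rewrite ltnS; apply: (@leq_trans (\sum_(i < n) R n i)%N); last by rewrite sizeR.
    rewrite (bigD1 (Ordinal lt_xn)) //=; apply: leq_trans (leq_addr _ _).
    exact: (gt_pattern_mono gtR x (geq_minr c n)).
  pose g : {ffun 'I_n.+1 * 'I_n -> 'I_B} := 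
    [ffun ci : 'I_n.+1 * 'I_n => inord (R (minn ci.1 n) ci.2)].
  have lamE c x : lamof g c x = R (minn c n) x.
    rewrite /lamof; case: insubP => [i lt_xn eq_x|]; last by rewrite -leqNgt => /zeroR.
    have le_c : (minn c n < n.+1)%N by rewrite ltnS geq_minr.
    by rewrite ffunE /= (inordK le_c) (minn_idPl (geq_minr c n)) eq_x inordK.
  have gP : condJ g.
    apply/asboolP; split; last first.
      by move=> c le_cn; under eq_bigr => i _ do rewrite lamE (minn_idPl le_cn); apply: sizeR.
    split; last by move=> i; rewrite !lamE minnn evenR.
    split=> [i|c i]; first by rewrite lamE min0n gtR.1.
    rewrite !lamE; case: (ltnP c n) => [lt_cn|le_nc].
      by rewrite (minn_idPl lt_cn); apply: gtR.2.
    by rewrite (minn_idPr (leqW le_nc)); split=> //; apply: (gt_pattern_decr gtR).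
  by exists (exist _ g gP) => c x; rewrite lamE.
have /choice[h hE] := rskP.
have h_inj : injective h.
  move=> f f' eq_h; apply/val_inj/ffunP => -[i j].
  case: (boolP (i < j)%N) => [lt_ij|nlt_ij]; last first.
    by case: f f' eq_h => [f /= /asboolP[_ f0]] [f' /= /asboolP[_ f'0]] _; rewrite f0 ?f'0.
  apply: val_inj; rewrite /= -!mofE.
  apply: (@rsk_inj (mof (val f)) (mof (val f')) n) => // c x le_cn.
  by have := hE f' c x; rewrite -eq_h hE (minn_idPl le_cn).
have leIJ := leq_card h h_inj.
pose e (f : I) := entry_mon (mof (val f)); pose st (g : J) := std_product (lamof (val g)).
have inI v' : has_content k v' -> exists f, v' = e f.
  case=> m [eqm ->].
  pose f : {ffun 'I_n * 'I_n -> 'I_B} :=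
    [ffun ij : 'I_n * 'I_n => inord (if (ij.1 < ij.2)%N then m ij.1 ij.2 else 0)].
  have fE (b : 'I_n) (a : 'I_b) : mof f a b = m a b.
    have lt_an : (a < n)%N by apply: ltn_trans (ltn_ord a) (ltn_ord b).
    rewrite -[X in mof f X _]/(val (Ordinal lt_an)) mofE ffunE /= ltn_ord inordK //.
    by rewrite ltnS; apply: content_bound eqm _ _.
  have fP : condI f.
    apply/asboolP; split=> [x lt_x|i j nlt_ij].
      rewrite -eqm // /letter_count; apply: eq_bigr => b _; apply: eq_bigr => a _.
      by rewrite fE.
    by apply: val_inj; rewrite ffunE /= (negPf nlt_ij) inordK.
  exists (exist _ f fP); rewrite /e /= /entry_mon; apply: eq_bigr => b _; apply: eq_bigr => a _.
  by rewrite fE.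
have st_span g : spanned (fun v => exists f, v = e f) (st g).
  case: g => g gP; have /asboolP[stdg contg] := gP.
  by apply: spanned_sub (spanned_content_std stdg contg) => v' /inI; apply: spanned_in.
have st_free (a : J -> F) : \sum_g a g *: st g = 0 -> forall g, a g = 0.
  apply: std_free => [[g gP]|g g' eq_g].
    by have /asboolP[] := gP.
  apply/val_inj/ffunP => -[c i]; apply: val_inj.
  have := eq_g c i; rewrite -ltnS ltn_ord ltn_ord => /(_ isT isT).
  by rewrite /lamof !valK (minn_idPl _) ?inord_val // -ltnS.
case/inI=> f ->; apply: spanned_sub (spanned_exchange leIJ st_span st_free f) => _ [g ->].
apply: spanned_in; exists (lamof (val g)).
by case: g => g gP; have /asboolP[] := gP.
Qed.
End Contents.

(** * Independence of tableau products from their lowest monomials *)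

Lemma rmorph_del (R R' : comNzRingType) (f : {rmorphism R -> R'}) G s :
  f (del G s) = del (fun y t => f (G y t)) s.
Proof.
by elim: s G => [|x s IH] G /=; rewrite ?rmorph0 // rmorphB IH.
Qed.

Lemma rmorph_pf (R R' : comNzRingType) (f : {rmorphism R -> R'}) Y s :
  f (pf Y s) = pf (fun a b => f (Y a b)) s.
Proof.
have [l] := ubnP (size s); elim: l s => // l IH [|x s] lt_s; first by rewrite !pf_nil rmorph1.
rewrite !pf_cons rmorph_del; apply: eq_del_in => pre y suf eqs.
by rewrite rmorphM IH //; have := size_del eqs; move: lt_s => /=; lia.
Qed.

Section Injectivity.
Variables (F : fieldType) (N : nat) (w : 'I_N -> nat) (n d : nat).
Local Notation D := {mpoly F[N]}.
Variable om : nat -> nat -> int.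
Hypothesis om_sub : forall a b i j, (a < b)%N -> (b < n)%N -> (i < j)%N ->
  om a i + om b j < om a j + om b i.
Hypothesis om_incr : forall a i, (a < n)%N -> om a i < om a i.+1.
Variables (c : nat -> nat -> D) (mon : nat -> nat -> 'X_{1..N}) (allowed : nat -> nat -> bool).
Hypothesis c_ge : forall a i, (a < n)%N -> wt_ge w (om a i) (c a i).
Hypothesis c_low : forall a i, (a < n)%N -> allowed a i ->
  lowest w (c a i) (mon a i) /\ wt w (mon a i) = om a i.

Definition table_mon (e : nat -> nat -> nat) u :=
  (\sum_(i < n) \sum_(a < n) e a i * mon a i u)%N.

(** The lowest monomial of a product has to determine the tableau. *)
Hypothesis mon_sep : forall e e' : nat -> nat -> nat,
  (forall a i, (a < n)%N -> (i < n)%N -> (0 < e a i)%N -> allowed a i) ->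
  (forall a i, (a < n)%N -> (i < n)%N -> (0 < e' a i)%N -> allowed a i) ->
  (forall u, table_mon e u = table_mon e' u) ->
  forall a i, (a < n)%N -> (i < n)%N -> e a i = e' a i.

Variables (P : comAlgType F) (y : nat -> nat -> P) (phi : {rmorphism P -> D}).
Hypothesis phiZ : forall a p, phi (a *: p) = a *: phi p.
Hypothesis phi_y : forall a b, (a < n)%N -> (b < n)%N -> phi (y a b) = blocks c d 0 a b.

Definition admissible lam := [/\ std_pattern n lam,
  forall i j, (j < lam n i)%N -> allowed (letter lam n i j) i &
  forall j, (height lam n j <= d.*2)%N].

Definition lowest_mon lam : 'X_{1..N} :=
  \big[mnm_add/0%MM]_(j < lam n 0%N) column_mon mon 0 (column lam n j).

Lemma column_mon_iota k h f u :
  column_mon mon k [seq f i | i <- iota k h] u = (\sum_(i <- iota k h) mon (f i) i u)%N.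
Proof.
elim: h k => [|h IH] k /=; first by rewrite big_nil mnm0E.
by rewrite big_cons mnmDE IH.
Qed.

Lemma column_allowed_iota k h f : (forall i, (k <= i < k + h)%N -> allowed (f i) i) ->
  column_allowed allowed k [seq f i | i <- iota k h].
Proof.
elim: h k => [|h IH] k //= al; rewrite al ?IH ?leqnn //=; last by lia.
by move=> i lt_i; apply: al; lia.
Qed.

(** The lowest monomial only depends on how often each letter occurs in each row. *)
Lemma lowest_monE lam u : gt_pattern lam ->
  lowest_mon lam u = table_mon (multiplicity lam n) u.
Proof.
move=> gt; rewrite /lowest_mon /table_mon -(sum_columns n gt (fun a i => mon a i u)).
rewrite (big_morph (fun m : 'X_{1..N} => m u) (id1 := 0%N) (op1 := addn)) //=.
- by apply: eq_bigr => j _; rewrite column_mon_iota.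
- by move=> m m'; rewrite mnmDE.
by rewrite mnm0E.
Qed.

Lemma std_lowest lam : admissible lam -> lowest w (phi (std_product n y lam)) (lowest_mon lam).
Proof.
case=> -[gt even] al le_d; rewrite rmorph_prod; apply: lowest_prod => j.
have lt_n := column_letter_lt n gt j.
rewrite rmorph_pf (@eq_pf _ _ (blocks c d 0)); last first.
  by move=> a b /(allP lt_n) lt_a /(allP lt_n) lt_b; apply: phi_y.
apply: (pf_blocks_lowest om_sub om_incr c_ge c_low (k := 0)).
- by rewrite column_sorted.
- by rewrite size_map size_iota height_even.
- by rewrite size_map size_iota.
by apply: column_allowed_iota => i; rewrite add0n height_gt // => /al.
Qed.

Lemma lowest_mon_inj lam lam' : admissible lam -> admissible lam' ->
    lowest_mon lam = lowest_mon lam' ->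
  forall k i, (k <= n)%N -> lam k i = lam' k i.
Proof.
have al_mult lam0 : admissible lam0 -> forall a i, (a < n)%N -> (i < n)%N ->
    (0 < multiplicity lam0 n a i)%N -> allowed a i.
  case=> -[gt _] al _ a i lt_a _; rewrite lt0n => /eqP mult0.
  apply/negPn/negP => nal; apply: mult0; rewrite /multiplicity big1 // => j _.
  case: (letter lam0 n i j =P a) => // eq_a; move: nal; rewrite -eq_a al //.
  by rewrite -(@letter_lt _ n gt n) // eq_a.
move=> adm adm' eq_mon k i le_kn.
have [[gt _] _ _] := adm; have [[gt' _] _ _] := adm'.
case: (ltnP i n) => [lt_in|le_ni]; last by rewrite !(gt_pattern_zero _ (leq_trans le_kn le_ni)).
rewrite !(multiplicity_sum _ _ le_kn) //; apply: eq_bigr => a _.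
apply: mon_sep (al_mult _ adm) (al_mult _ adm') _ _ _ _ lt_in.
  by move=> u; rewrite -!lowest_monE // eq_mon.
exact: leq_trans (ltn_ord a) le_kn.
Qed.

Lemma eq_std lam lam' : (forall k i, (k <= n)%N -> lam k i = lam' k i) ->
  std_product n y lam = std_product n y lam'.
Proof.
move=> eq_lam; rewrite /std_product eq_lam //; apply: eq_bigr => j _; congr pf.
rewrite /column /height (eq_count (a2 := fun i => (j < lam' n i)%N)).
  by apply: eq_map => i; apply: eq_bigr => k _; rewrite eq_lam.
by move=> i; rewrite eq_lam.
Qed.

Lemma admissible_free (J : finType) (lam : J -> nat -> nat -> nat) (a : J -> F) :
    (forall j, admissible (lam j)) ->
    (forall i j, (forall k x, (k <= n)%N -> (x < n)%N -> lam i k x = lam j k x) -> i = j) ->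
  \sum_j a j *: std_product n y (lam j) = 0 -> forall j, a j = 0.
Proof.
move=> adm lam_inj sum0 j.
have := @lowest_free _ _ w J (index_enum J) a (fun j => phi (std_product n y (lam j)))
  (fun j => lowest_mon (lam j)).
apply; rewrite ?index_enum_uniq ?mem_index_enum //.
- by move=> i _; apply: std_lowest.
- move=> i i' _ _ /(lowest_mon_inj (adm i) (adm i')) eq_lam.
  by apply: lam_inj => k x le_kn _; apply: eq_lam.
by rewrite -[RHS](rmorph0 phi) -sum0 rmorph_sum; apply: eq_bigr => i _; rewrite /= phiZ.
Qed.

(** Products with the same lowest monomial come from the same tableau and can be
collected, after which [lowest_free] applies. *)
Lemma spanned_admissible_inj u :
  spanned (fun v => exists2 lam, admissible lam & v = std_product n y lam) u -> phi u = 0 -> u = 0.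
Proof.
move=> Su.
pose isstd m v := exists lam, [/\ admissible lam, v = std_product n y lam & lowest_mon lam = m].
have isstd_inj m v v' : isstd m v -> isstd m v' -> v = v'.
  move=> [lam [adm -> eqm]] [lam' [adm' -> eqm']]; apply: eq_std.
  by apply: lowest_mon_inj => //; rewrite eqm.
have [s [a [v [us sv ->]]]] : exists s (a : 'X_{1..N} -> F) v,
    [/\ uniq s, forall m, m \in s -> isstd m (v m) & u = \sum_(m <- s) a m *: v m].
  elim: Su => [|b x u' [lam adm eqx] _ [s [a [v [us sv ->]]]]].
    by exists [::], (fun=> 0), (fun=> 0); split=> //; rewrite big_nil.
  set m0 := lowest_mon lam; have x_std : isstd m0 x by exists lam.
  have [m0s|m0s] := boolP (m0 \in s).
    exists s, (fun m => (if m == m0 then b else 0) + a m), v; split=> //.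
    under [RHS]eq_bigr => m _ do rewrite scalerDl.
    rewrite big_split; congr (_ + _); rewrite (bigD1_seq m0) //= eqxx.
    rewrite big1 ?addr0 => [|m /negPf ->]; last by rewrite scale0r.
    by rewrite (isstd_inj _ _ _ x_std (sv _ m0s)).
  exists (m0 :: s), (fun m => if m == m0 then b else a m), (fun m => if m == m0 then x else v m).
  split; first by rewrite /= m0s.
    move=> m; rewrite inE; case: eqP => [-> //|_ /= /sv]; exact.
  rewrite big_cons eqxx; congr (_ + _); rewrite !big_seq; apply: eq_bigr => m m_s.
  by case: eqP => // eqm; rewrite -eqm m_s in m0s.
move=> phi0; rewrite big_seq big1 // => m m_s.
have := @lowest_free _ _ w _ s a (phi \o v) id.
move=> ->; rewrite ?scale0r //.
- by move=> m' /sv [lam [adm eqv eqm]]; rewrite /= eqv -eqm; apply: std_lowest.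
by rewrite -[RHS]phi0 rmorph_sum; apply: eq_bigr => m' _; rewrite /= phiZ.
Qed.
End Injectivity.

(** * Reduction to symplectic tableaux modulo the ideal *)

Section Straightening.
Variables (F : fieldType) (P : comAlgType F) (I : idealr P) (r : nat).
Local Notation n := r.*2.
Variable y : nat -> nat -> P.
Hypotheses (yxx : forall a, y a a = 0) (yC : forall a b, y a b = - y b a).
Hypothesis two_neq0 : 2%:R != 0 :> F.
Hypothesis fact_neq0 : forall m, (m <= r)%N -> m`!%:R != 0 :> F.
Hypothesis trI : \sum_(p <- iota 0 r) y p.*2 p.*2.+1 \in I.
Hypothesis isoI : forall a b,
  \sum_(p <- iota 0 r) (y p.*2 a * y p.*2.+1 b - y p.*2 b * y p.*2.+1 a) \in I.
Hypothesis basis : forall k v, has_content n y k v ->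
  spanned (fun u => exists lam, [/\ std_pattern n lam, pattern_content n k lam &
    u = std_product n y lam]) v.

(** King's condition: the first [i] rows hold all the letters of the first [i] pairs.
Rows increase, so it is enough to look at the first column. *)
Definition symplectic lam := std_pattern n lam /\
  forall i, (0 < lam n i)%N -> (i.*2 <= letter lam n i 0)%N.

Definition reducible v := exists2 u,
  spanned (fun v => exists2 lam, symplectic lam & v = std_product n y lam) u & v - u \in I.

Lemma idealZ (a : F) u : u \in I -> a *: u \in I.
Proof. by move=> uI; rewrite -[u]mul1r scalerAl idealMr. Qed.

Lemma reducible_spanned S v : (forall u, S u -> reducible u) -> spanned S v -> reducible v.
Proof.
move=> redS; elim=> [|a w u /redS [w' Sw ww'] _ [u' Su uu']].
  by exists 0; [exact: spanned0 | rewrite subrr rpred0].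
exists (a *: w' + u'); first by apply: spannedD => //; apply: spannedZ.
by rewrite opprD addrACA -scalerBr rpredD ?idealZ.
Qed.

Lemma reducible_mod v v' : v - v' \in I -> reducible v' -> reducible v.
Proof.
move=> vv' [u Su uv']; exists u => //.
by rewrite -[v](subrK v') -addrA rpredD.
Qed.

Definition content_coweight (k : nat -> nat) := (\sum_(x < n) k x * (r - x./2))%N.

Lemma content_coweight_count s : all (fun a => a < n)%N s ->
  content_coweight (fun x => count_mem x s) = coweight r s.
Proof.
rewrite /content_coweight /coweight; elim: s => [|a s IH] /=; first by rewrite big_nil big1.
case/andP=> lt_a /IH eqs; rewrite big_cons -eqs.
under eq_bigr => x _ do rewrite mulnDl.
rewrite big_split /=; congr addn; rewrite (bigD1 (Ordinal lt_a)) //= eqxx mul1n.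
rewrite big1 ?addn0 // => x neq; rewrite -[a == x :> nat]/(Ordinal lt_a == x) eq_sym.
by rewrite (negPf neq).
Qed.

Lemma first_column_bad lam : std_pattern n lam -> ~ symplectic lam ->
  exists2 i, (i <= r)%N & (i < count (fun a => a < i.*2)%N (column lam n 0))%N.
Proof.
move=> [gt even] nsym.
have [i lam_i lt_i] : exists2 i, (0 < lam n i)%N & (letter lam n i 0 < i.*2)%N.
  apply: contrapT => no; apply: nsym; split=> // i lam_i; rewrite leqNgt; apply/negP => lt_i.
  by apply: no; exists i.
have lt_n i' : (i' <= i)%N -> (letter lam n i' 0 < n)%N.
  by move=> le_i; rewrite letter_lt //; apply: leq_trans lam_i (gt_pattern_decr gt n le_i).
have mono i' : (i' <= i)%N -> (letter lam n i' 0 <= letter lam n i 0)%N.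
  move=> le_i; have [j eqj] : exists j, (i - j)%N = i' /\ (j <= i)%N by exists (i - i')%N; lia.
  case: eqj => <- {le_i i'}; elim: j => [|j IH] le_j; first by rewrite subn0.
  apply: leq_trans (IH (ltnW le_j)); have -> : (i - j)%N = (i - j.+1).+1 by lia.
  by apply: ltnW; apply: letter_gt => //; apply: lt_n; lia.
exists (minn i r); first by rewrite geq_minr.
have le_h : (i < height lam n 0)%N by rewrite height_gt.
rewrite /column -(subnKC le_h) iotaD map_cat count_cat count_map.
apply: leq_trans (leq_addr _ _).
have /eqP-> : count (preim (letter lam n ^~ 0) (fun a => a < (minn i r).*2)%N) (iota 0 i.+1) == i.+1.
  rewrite -[X in _ == X](size_iota 0) -all_count; apply/allP => i'.
  rewrite mem_iota /= add0n ltnS => le_i'.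
  have := mono _ le_i'; have := lt_n _ le_i'; move: lt_i => /=.
  by move: (letter _ _ i' _) (letter _ _ i _) => x x'; lia.
by rewrite ltnS geq_minl.
Qed.

(** Induction on the coweight. A tableau that is not symplectic violates the condition in
its first column; straightening this column lowers the coweight, and the resulting
products are expanded in the basis again. *)
Lemma content_reducible k v : has_content n y k v -> reducible v.
Proof.
have [l] := ubnP (content_coweight k); elim: l k v => // l IH k v lt_k /basis.
apply: reducible_spanned => _ [lam [std_lam cont_lam ->]].
have [sym|nsym] := pselect (symplectic lam).
  by exists (std_product n y lam); [apply: spanned_in; exists lam | rewrite subrr rpred0].
have [i le_ir bad] := first_column_bad std_lam nsym.
have [gt even] := std_lam.
have [L eqL] : exists L, lam n 0%N = L.+1.
  exists (lam n 0%N).-1; rewrite prednK // -height_gt // lt0n; apply/eqP => h0.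
  by move: bad; rewrite /column h0.
have srt := column_sorted n gt 0; have lt_n := column_letter_lt n gt 0.
have halfE : 2%:R * (2%:R^-1 : F)%:A = 1 :> P.
  by rewrite mulr_natl scalerMnl -[_ *+ 2]mulr_natl divff // scale1r.
have uniq_c : uniq (column lam n 0) by apply: sorted_uniq srt; [exact: ltn_trans | exact: ltnn].
have [m [b [zs [le_mr zsP memI]]]] :=
  column_straighten yxx yC halfE trI isoI le_ir uniq_c lt_n bad.
pose rest := \prod_(j < L) pf y (column lam n j.+1).
have eq_std : std_product n y lam = pf y (column lam n 0) * rest.
  by rewrite /std_product eqL big_ord_recl.
pose v' := \sum_(s <- zs) ((-1) ^+ b * m`!%:R^-1 : F) *: (pf y s * rest).
apply: (@reducible_mod _ v').
  have -> : std_product n y lam - v' = (m`!%:R^-1 : F) *: (rest *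
      (m`!%:R * pf y (column lam n 0) - (-1) ^+ b * \sum_(s <- zs) pf y s)).
    have e1 u : m`!%:R * u = (m`!%:R : F) *: u by rewrite mulr_natl scaler_nat.
    have e2 (u : P) : (-1) ^+ b * u = ((-1) ^+ b : F) *: u.
      by case: (b : bool); rewrite ?expr1 ?mulN1r ?scaleN1r // expr0 mul1r scale1r.
    rewrite e1 e2 mulrBr -!scalerAr scalerBr !scalerA mulVf ?fact_neq0 // scale1r.
    rewrite eq_std mulrC /v' -scaler_sumr -mulr_suml [_ * rest]mulrC.
    by rewrite [(-1) ^+ b * _]mulrC.
  by rewrite idealZ // idealMr.
apply: (@reducible_spanned (fun u => exists2 k', (content_coweight k' < l)%N & has_content n y k' u)).
  by move=> u [k' lt_k' /(IH _ _ lt_k')].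
rewrite /v' big_seq; elim/big_rec: _ => [|s u /zsP[lt_s lt_codeg] IHu]; first exact: spanned0.
apply: spannedD IHu; apply: spannedZ.
pose k' x := (count_mem x s + \sum_(j < L) count_mem x (column lam n j.+1))%N.
have lt_k' : (content_coweight k' < l)%N.
  rewrite ltnS in lt_k; apply: leq_trans lt_k.
  have -> : content_coweight k = (content_coweight (fun x => count_mem x (column lam n 0)) +
      content_coweight (fun x => \sum_(j < L) count_mem x (column lam n j.+1)))%N.
    rewrite /content_coweight -big_split; apply: eq_bigr => x _ /=.
    rewrite -(column_size_count gt cont_lam (ltn_ord x)) eqL big_ord_recl /=.
    by rewrite mulnDl.
  have -> : content_coweight k' = (content_coweight (fun x => count_mem x s) +
      content_coweight (fun x => \sum_(j < L) count_mem x (column lam n j.+1)))%N.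
    by rewrite /content_coweight -big_split; apply: eq_bigr => x _ /=; rewrite mulnDl.
  by rewrite !content_coweight_count // ltn_add2r.
have spf := spanned_content_pf yxx yC lt_s.
have srest := @spanned_content_prod _ _ n _ yxx yC _ (index_enum 'I_L)
  (fun j => column lam n j.+1) (fun j => column_letter_lt n gt j.+1).
have : spanned (has_content n y k') (pf y s * rest) by apply: spanned_contentM spf srest.
by apply: spanned_sub => u' cu'; apply: spanned_in; exists k'.
Qed.
End Straightening.

(** * The coordinates and the equations of V *)

Section Letters.
Variable r : nat.

Definition letter_of (i : 'I_(r + r)) : nat :=
  match split i with inl p => p.*2 | inr p => p.*2.+1 end.

Lemma letter_of_l (p : 'I_r) : letter_of (lshift r p) = p.*2.
Proof. by rewrite /letter_of (unsplitK (inl p)). Qed.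

Lemma letter_of_r (p : 'I_r) : letter_of (rshift r p) = p.*2.+1.
Proof. by rewrite /letter_of (unsplitK (inr p)). Qed.

Lemma letter_of_lt i : (letter_of i < r.*2)%N.
Proof.
by case: (split_ordP i) => p ->; rewrite ?letter_of_l ?letter_of_r; have := ltn_ord p; lia.
Qed.

Lemma symplectic_mulu (R : pzRingType) m (Z : 'M[R]_(r + r, m)) p j :
  (symplectic_mx R r *m Z) (lshift r p) j = Z (rshift r p) j.
Proof.
rewrite -[Z in LHS]vsubmxK mul_block_col !mul0mx mul1mx add0r col_mxEu.
by rewrite mxE.
Qed.

Lemma symplectic_muld (R : pzRingType) m (Z : 'M[R]_(r + r, m)) p j :
  (symplectic_mx R r *m Z) (rshift r p) j = - Z (lshift r p) j.
Proof.
rewrite -[Z in LHS]vsubmxK mul_block_col !mul0mx mulNmx addr0 col_mxEd.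
by rewrite mul1mx !mxE.
Qed.

Lemma symplectic_form (R : comNzRingType) m (Z Z' : 'M[R]_(r + r, m)) i j :
  (Z^T *m symplectic_mx R r *m Z') i j =
  \sum_(p < r) (Z (lshift r p) i * Z' (rshift r p) j - Z (rshift r p) i * Z' (lshift r p) j).
Proof.
rewrite -mulmxA mxE big_split_ord /= -big_split; apply: eq_bigr => p _ /=.
by rewrite symplectic_mulu symplectic_muld ![Z^T _ _]mxE mulrN.
Qed.
Variable r_gt0 : (0 < r)%N.

Definition ord_of (p : nat) : 'I_r := insubd (Ordinal r_gt0) p.

(** Letters are numbered so that the two basis vectors paired by the symplectic form come
next to each other. *)
Definition index_of (a : nat) : 'I_(r + r) :=
  if odd a then rshift r (ord_of a./2) else lshift r (ord_of a./2).

Lemma ord_ofK (p : 'I_r) : ord_of p = p.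
Proof. exact: valKd. Qed.

Lemma index_of_even (p : 'I_r) : index_of p.*2 = lshift r p.
Proof. by rewrite /index_of odd_double doubleK ord_ofK. Qed.

Lemma index_of_odd (p : 'I_r) : index_of p.*2.+1 = rshift r p.
Proof. by rewrite /index_of doubleSK oddS odd_double ord_ofK. Qed.

Lemma letter_ofK i : index_of (letter_of i) = i.
Proof.
case: (split_ordP i) => p ->; first by rewrite letter_of_l index_of_even.
by rewrite letter_of_r index_of_odd.
Qed.

Lemma index_ofK a : (a < r.*2)%N -> letter_of (index_of a) = a.
Proof.
move=> lt_a; have lt_p : (a./2 < r)%N by lia.
have := odd_double_half a; rewrite /index_of; case: (odd a) => /=.
  by rewrite letter_of_r val_insubd lt_p.
by rewrite letter_of_l val_insubd lt_p.
Qed.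

End Letters.

Section Coordinates.
Variables (F : fieldType) (r : nat) (r_gt0 : (0 < r)%N).
Local Notation P := (mxpolyring F (r + r)).
Local Notation Y := (generic_mx F (r + r)).
Local Notation I := (@V_ideal F r).
Local Notation idx := (index_of r_gt0).

(** The generic matrix, modified to be alternating as a matrix of polynomials and not only
modulo the ideal. *)
Definition entry (a b : nat) : P :=
  if (a < b)%N then Y (idx a) (idx b)
  else if (b < a)%N then - Y (idx b) (idx a) else 0.

Lemma entryxx a : entry a a = 0.
Proof. by rewrite /entry ltnn. Qed.

Lemma entryC a b : entry a b = - entry b a.
Proof. by rewrite /entry; case: (ssrnat.ltngtP a b); rewrite ?opprK ?oppr0. Qed.

Lemma V_equation_ideal (p : P) : V_equation p -> p \in I.
Proof.
move=> Vp; apply/asboolP; exists 1%N, (fun=> 1), (fun=> p).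
by split=> //; rewrite big_ord1 mul1r.
Qed.

Lemma entry_mod a b : Y (idx a) (idx b) - entry a b \in I.
Proof.
rewrite /entry; case: (ssrnat.ltngtP a b) => [_|_|->].
- by rewrite subrr rpred0.
- by have := V_equation_ideal (@V_skew F r (idx a) (idx b)); rewrite !mxE.
by rewrite subr0; apply/V_equation_ideal/V_diag.
Qed.

Lemma ideal_congrM (u v u' v' : P) : u - u' \in I -> v - v' \in I -> u * v - u' * v' \in I.
Proof.
move=> uu' vv'; have -> : u * v - u' * v' = v * (u - u') + u' * (v - v') by ring.
by rewrite rpredD ?idealMr.
Qed.

Hypothesis two_neq0 : 2%:R != 0 :> F.

(** Modulo the ideal and up to sign, the sum is half the trace of JY, which is a
coefficient of the characteristic polynomial. *)
Lemma entry_trace : \sum_(p <- iota 0 r) entry p.*2 p.*2.+1 \in I.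
Proof.
have -> : \sum_(p <- iota 0 r) entry p.*2 p.*2.+1 = \sum_(p < r) entry p.*2 p.*2.+1.
  by rewrite -(big_mkord xpredT (fun p => entry p.*2 p.*2.+1)) /index_iota subn0.
set t := \sum_(p < r) _.
have: \tr (symplectic_mx P r *m Y) \in I.
  have := V_equation_ideal (@V_char_poly F r (r + r).-1).
  rewrite char_poly_trace; last by rewrite addn_gt0 r_gt0.
  rewrite coefXn ltn_eqF; last by rewrite prednK ?addn_gt0 ?r_gt0.
  by rewrite subr0 raddfN opprK.
rewrite /mxtrace big_split_ord /= -big_split /= => tr_in.
have: (2%:R : F) *: t \in I.
  rewrite scaler_nat mulr2n -[t + t]opprK rpredN opprD /t -!sumrN -big_split /=.
  rewrite -[X in X \in I](subrK (\sum_(p < r) ((symplectic_mx P r *m Y) (lshift r p) (lshift r p) +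
     (symplectic_mx P r *m Y) (rshift r p) (rshift r p)))) rpredD // -sumrB.
  apply: rpred_sum => p _; rewrite symplectic_mulu symplectic_muld.
  have e1 := entry_mod p.*2 p.*2.+1; have e2 := entry_mod p.*2.+1 p.*2.
  rewrite index_of_even index_of_odd in e1 e2; rewrite entryC in e2.
  set x := Y _ _ in e1 *; set x' := Y _ _ in e2 *; set z := entry _ _ in e1 e2 *.
  have -> : - z - z - (x' - x) = (x - z) - (x' - - z) by ring.
  exact: rpredB.
move=> /(idealZ (2%:R^-1)); rewrite scalerA mulVf // scale1r; exact.
Qed.

Lemma entry_isotropic a b :
  \sum_(p <- iota 0 r) (entry p.*2 a * entry p.*2.+1 b - entry p.*2 b * entry p.*2.+1 a) \in I.
Proof.
pose f p := entry p.*2 a * entry p.*2.+1 b - entry p.*2 b * entry p.*2.+1 a.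
have -> : \sum_(p <- iota 0 r) f p = \sum_(p < r) f p.
  by rewrite -(big_mkord xpredT f) /index_iota subn0.
have := V_equation_ideal (@V_isotropic F r (idx a) (idx b)); rewrite symplectic_form => iso_in.
set z := \sum_(p < r) _ in iso_in; set t := \sum_(p < r) _.
rewrite -[t](subKr z) rpredB // /z /t -sumrB; apply: rpred_sum => p _.
have regroup (A B C D : P) : A - B - (C - D) = (A - C) - (B - D) by ring.
rewrite /f regroup -(index_of_even r_gt0) -(index_of_odd r_gt0) rpredB //.
  by apply: ideal_congrM; apply: entry_mod.
by rewrite [Y _ _ * _]mulrC; apply: ideal_congrM; apply: entry_mod.
Qed.

Lemma ideal_congrX (u u' : P) k : u - u' \in I -> u ^+ k - u' ^+ k \in I.
Proof.
move=> uu'; elim: k => [|k IH]; first by rewrite subrr rpred0.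
by rewrite !exprS; apply: ideal_congrM.
Qed.

Lemma content_mod (p : P) : exists2 u,
  spanned (fun v => exists k, has_content r.*2 entry k v) u & p - u \in I.
Proof.
pose S (v : P) := exists k, has_content r.*2 entry k v.
have S1 : S 1 by exists (fun=> 0%N), (fun _ _ => 0%N); split;
  [move=> x _; rewrite /letter_count big1 // => b _; rewrite big1 |
   rewrite /entry_mon big1 // => b _; rewrite big1 // => a _; rewrite expr0].
have SM u v : spanned S u -> spanned S v -> spanned S (u * v).
  move=> Su Sv; elim: Su => [|a w u' [k Sw] _ IH]; first by rewrite mul0r; apply: spanned0.
  rewrite mulrDl -scalerAl; apply: spannedD IH; apply: spannedZ.
  elim: Sv => [|b w' v' [k' Sw'] _ IH]; first by rewrite mulr0; apply: spanned0.
  rewrite mulrDr -scalerAr; apply: spannedD IH; apply: spannedZ.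
  have := @spanned_contentM _ _ _ _ k k' (fun x => k x + k' x)%N _ _ (fun x _ => erefl)
    (spanned_in Sw) (spanned_in Sw').
  by apply: spanned_sub => u'' cu; apply: spanned_in; exists (fun x => k x + k' x)%N.
have SX i : exists2 u, spanned S u & 'X_i - u \in I.
  case/mxvec_indexP: i => i j; exists (entry (letter_of i) (letter_of j)).
    have := @spanned_content_y _ _ _ _ entryxx entryC _ _ (letter_of_lt i) (letter_of_lt j).
    by apply: spanned_sub => u cu; apply: spanned_in; eexists; exact: cu.
  have := entry_mod (letter_of i) (letter_of j); rewrite !letter_ofK.
  by rewrite mxE.
elim/mpolyind: p => [|c m p _ _ [u Su pu]].
  by exists 0; [exact: spanned0 | rewrite subrr rpred0].
suff [v Sv mv] : exists2 v, spanned S v & 'X_[m] - v \in I.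
  exists (c *: v + u); first by apply: spannedD => //; apply: spannedZ.
  by rewrite opprD addrACA -scalerBr rpredD // idealZ.
rewrite mpolyXE_id; elim/big_rec: _ => [|i q _ [v Sv qv]].
  by exists 1; [apply: spanned_in | rewrite subrr rpred0].
have [u' Su' iu'] := SX i.
exists (u' ^+ m i * v); last by apply: ideal_congrM => //; apply: ideal_congrX.
apply: (SM) => //; elim: (m i) => [|l IH]; first by apply: spanned_in.
by rewrite exprS; apply: SM.
Qed.
End Coordinates.

(** * Generic frames *)

Section Frames.
Variables (F : fieldType) (n : nat).
Local Notation N := (n * n).+1.
Local Notation D := {mpoly F[N]}.

(** The variables are indexed by pairs [a, i < n]. One more variable makes their number
visibly positive. *)
Definition var_index (a i : nat) : 'I_N := inord (a * n + i).

Definition var a i : D := 'X_(var_index a i).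

Lemma var_indexE a i : (a < n)%N -> (i < n)%N -> var_index a i = (a * n + i)%N :> nat.
Proof. by move=> lt_a lt_i; rewrite inordK // ltnS; nia. Qed.

Lemma var_index_eq a i b j : (a < n)%N -> (i < n)%N -> (b < n)%N -> (j < n)%N ->
  (var_index a i == var_index b j) = (a == b) && (i == j).
Proof.
move=> lt_a lt_i lt_b lt_j; apply/eqP/andP => [eqv|[/eqP-> /eqP->]] //.
have := congr1 (@nat_of_ord _) eqv; rewrite !var_indexE // => eqn.
have := congr1 (divn^~ n) eqn.
by rewrite !divnMDl ?(divn_small lt_i) ?(divn_small lt_j); lia.
Qed.

Definition weight_of (W : nat -> nat -> nat) (k : 'I_N) := W (k %/ n)%N (k %% n)%N.

Lemma weight_ofE W a i : (a < n)%N -> (i < n)%N -> weight_of W (var_index a i) = W a i.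
Proof.
move=> lt_a lt_i; rewrite /weight_of var_indexE // modnMDl modn_small //.
by rewrite divnMDl ?(divn_small lt_i) ?addn0 //; lia.
Qed.

Lemma sum_delta (e : nat -> nat -> nat) a0 i0 : (a0 < n)%N -> (i0 < n)%N ->
  (\sum_(i < n) \sum_(a < n) e a i * ((a == a0 :> nat) && (i == i0 :> nat)) = e a0 i0)%N.
Proof.
move=> lt_a lt_i; rewrite (bigD1 (Ordinal lt_i)) //= (bigD1 (Ordinal lt_a)) //= !eqxx muln1.
rewrite big1 => [|a neq]; last first.
  by rewrite -[a == a0 :> nat]/(a == Ordinal lt_a) (negPf neq) muln0.
rewrite big1 ?addn0 // => i neq; rewrite big1 // => a _.
by rewrite -[i == i0 :> nat]/(i == Ordinal lt_i) (negPf neq) andbF muln0.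
Qed.

Definition free_frame a i : D := if (i < n)%N then var a i else 0.
Definition free_om a i : int := (i * (n + n - a))%N%:Z.
Definition free_w := weight_of (fun a i => i * (n + n - a))%N.
Definition free_mon a i : 'X_{1..N} := U_(var_index a i)%MM.
Definition free_allowed (a i : nat) := (i < n)%N.

Lemma free_om_sub a b i j : (a < b)%N -> (b < n)%N -> (i < j)%N ->
  free_om a i + free_om b j < free_om a j + free_om b i.
Proof. by rewrite /free_om; nia. Qed.

Lemma free_om_incr a i : (a < n)%N -> free_om a i < free_om a i.+1.
Proof. by rewrite /free_om; nia. Qed.

Lemma free_frame_low a i : (a < n)%N -> free_allowed a i ->
  lowest free_w (free_frame a i) (free_mon a i) /\ wt free_w (free_mon a i) = free_om a i.
Proof.
rewrite /free_allowed /free_frame => lt_a lt_i; rewrite lt_i; split; first exact: lowestX.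
by rewrite wtU /free_w weight_ofE.
Qed.

Lemma free_frame_ge a i : (a < n)%N -> wt_ge free_w (free_om a i) (free_frame a i).
Proof.
move=> lt_a; case: (ltnP i n) => [lt_i|le_i].
  by have [/lowest_ge + <-] := free_frame_low lt_a lt_i.
by rewrite /free_frame ltnNge le_i; apply: wt_ge0.
Qed.

Lemma free_mon_sep (e e' : nat -> nat -> nat) :
  (forall u, table_mon n free_mon e u = table_mon n free_mon e' u) ->
  forall a i, (a < n)%N -> (i < n)%N -> e a i = e' a i.
Proof.
have tableE e0 a0 i0 : (a0 < n)%N -> (i0 < n)%N ->
    table_mon n free_mon e0 (var_index a0 i0) = e0 a0 i0.
  move=> lt_a lt_i; rewrite -[RHS]sum_delta //; apply: eq_bigr => i _; apply: eq_bigr => a _.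
  by rewrite mnm1E var_index_eq.
by move=> eq_t a i lt_a lt_i; rewrite -(tableE e) // -(tableE e') // eq_t.
Qed.
End Frames.

Section SymplecticFrame.
Variables (F : fieldType) (r : nat).
Local Notation n := r.*2.
Local Notation N := (n * n).+1.
Local Notation D := {mpoly F[N]}.
Local Notation var := (@var F n).

Definition iso_allowed (a i : nat) := (i.*2 <= a)%N.
Definition iso_w := @weight_of n (fun a i =>
  if a == i.*2 then 3 * n * i else (a - i.*2) * (n - i))%N.
(** The product [(a - 2i) (n - i)] is strictly submodular and vanishes for [a = 2i], where
the frame is normalized. It is negative for [a < 2i], so that it bounds the order of any
polynomial: nothing has to be known about the dependent entries. The first summand,
which comes from scaling the columns, makes the weights increase with [i]. *)
Definition iso_om (a i : nat) : int := (3 * n * i)%:Z + (a%:Z - i.*2%:Z) * (n%:Z - i%:Z).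
Definition iso_mon (a i : nat) : 'X_{1..N} :=
  (U_(var_index n i.*2 i) + (if a == i.*2 then 0 else U_(var_index n a i)))%MM.

Lemma iso_om_sub a b i j : (a < b)%N -> (b < n)%N -> (i < j)%N ->
  iso_om a i + iso_om b j < iso_om a j + iso_om b i.
Proof.
move=> lt_ab _ lt_ij; have: 0 < (b%:Z - a%:Z) * (j%:Z - i%:Z) by apply: mulr_gt0; lia.
rewrite /iso_om; lia.
Qed.

Lemma iso_om_incr a i : (a < n)%N -> iso_om a i < iso_om a i.+1.
Proof. rewrite /iso_om; lia. Qed.

(** The even rows of an isotropic frame form a unipotent lower triangular matrix L, the odd
rows a matrix N such that L^T N is symmetric. The lower triangle of N is free, and the
symmetry determines the rest: a strictly upper triangular U is added to the free part,
where L^T U has to be the upper half of the alternating matrix [defect]. *)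
Definition lower : 'M[D]_r := \matrix_(p, i)
  if p == i then 1 else if (i < p)%N then var p.*2 i else 0.
Definition free_part : 'M[D]_r := \matrix_(p, i)
  if (i <= p)%N then var p.*2.+1 i else 0.
Definition defect : 'M[D]_r := free_part^T *m lower - lower^T *m free_part.
Definition upper_defect : 'M[D]_r := \matrix_(i, j) if (i < j)%N then defect i j else 0.
Definition correction : 'M[D]_r := invmx lower^T *m upper_defect.
Definition dual_part : 'M[D]_r := free_part + correction.

Lemma lower_unit : lower^T \in unitmx.
Proof.
rewrite unitmx_tr unitmxE det_trig.
  by rewrite big1 ?unitr1 // => i _; rewrite mxE eqxx.
apply/is_trig_mxP => i j lt_ij; rewrite mxE -val_eqE /= ltn_eqF //.
by rewrite ltnNge ltnW.
Qed.

Lemma lower_correction : lower^T *m correction = upper_defect.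
Proof. by rewrite mulKVmx // lower_unit. Qed.

(** As L^T is unipotent and upper triangular, L^T U and U are strictly upper triangular
together; the entries are compared from the last row upwards. *)
Lemma correction_lower (i j : 'I_r) : (j <= i)%N -> correction i j = 0.
Proof.
have [l] := ubnP (r - i)%N; elim: l i => // l IH i le_l le_ji.
have := congr1 (fun A : 'M_r => A i j) lower_correction.
rewrite mxE [upper_defect i j]mxE ltnNge le_ji /= (bigD1 i) //=.
rewrite [lower^T i i]mxE [lower i i]mxE eqxx mul1r big1 ?addr0 // => k neq.
rewrite [lower^T i k]mxE [lower k i]mxE (negPf neq).
case: (ssrnat.ltngtP i k) => [lt_ik|lt_ki|/val_inj eq_ki]; rewrite ?mul0r //.
by rewrite IH ?mulr0 //; have := ltn_ord k; lia.
Qed.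

Lemma dual_part_free (p i : 'I_r) : (i <= p)%N -> dual_part p i = var p.*2.+1 i.
Proof. by move=> le_ip; rewrite mxE [free_part p i]mxE le_ip correction_lower ?addr0. Qed.

Lemma dual_part_sym (i j : 'I_r) :
  (lower^T *m dual_part) i j = (lower^T *m dual_part) j i.
Proof.
have LN (i' j' : 'I_r) : (lower^T *m dual_part) i' j' =
    if (i' < j')%N then (lower^T *m free_part) j' i' else (lower^T *m free_part) i' j'.
  rewrite mulmxDr lower_correction mxE [upper_defect i' j']mxE.
  case: ifP => _; last by rewrite addr0.
  have -> : defect = (lower^T *m free_part)^T - lower^T *m free_part.
    by rewrite trmx_mul trmxK.
  rewrite [X in _ + X]mxE [X in _ + (X + _)]mxE [X in _ + (_ + X)]mxE.
  by rewrite addrC subrK.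
rewrite !LN; move: (lower^T *m free_part) => E.
by case: (ssrnat.ltngtP i j) => // /val_inj ->.
Qed.

Lemma isotropic_columns (i j : 'I_r) :
  \sum_(p < r) (lower p i * dual_part p j - dual_part p i * lower p j) = 0.
Proof.
have := dual_part_sym i j; rewrite [LHS]mxE [RHS]mxE => /eqP; rewrite -subr_eq0 -sumrB => /eqP eq0.
rewrite -[RHS]eq0; apply: eq_bigr => p _.
by rewrite ![lower^T _ _]mxE [lower p j * _]mulrC.
Qed.

(** Column [i] is multiplied by the variable with index [(2i, i)], which is not used
otherwise since L has diagonal entries 1. *)
Definition iso_frame (a i : nat) : D :=
  match insub i, insub a./2 with
  | Some i', Some p => var i.*2 i * (if odd a then dual_part p i' else lower p i')
  | _, _ => 0
  end.

Lemma iso_frame_even (p i : 'I_r) : iso_frame p.*2 i = var i.*2 i * lower p i.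
Proof. by rewrite /iso_frame doubleK !valK odd_double. Qed.

Lemma iso_frame_odd (p i : 'I_r) : iso_frame p.*2.+1 i = var i.*2 i * dual_part p i.
Proof. by rewrite /iso_frame doubleSK !valK oddS odd_double. Qed.

Lemma iso_frame_isotropic i j :
  \sum_(p < r) (iso_frame p.*2 i * iso_frame p.*2.+1 j - iso_frame p.*2.+1 i * iso_frame p.*2 j) = 0.
Proof.
have zero k a : (r <= k)%N -> iso_frame a k = 0.
  by move=> le_rk; rewrite /iso_frame insubF // ltnNge le_rk.
case: (ltnP i r) => [lt_i|/zero z]; last by rewrite big1 // => p _; rewrite !z !mul0r subrr.
case: (ltnP j r) => [lt_j|/zero z]; last by rewrite big1 // => p _; rewrite !z !mulr0 subrr.
have -> : i = Ordinal lt_i by []. have -> : j = Ordinal lt_j by [].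
move: (Ordinal lt_i) (Ordinal lt_j) => i' j'.
pose z := var i'.*2 i' * var j'.*2 j'.
have := congr1 ( *%R z) (isotropic_columns i' j'); rewrite mulr0 mulr_sumr => eq0.
rewrite -[RHS]eq0 /z; apply: eq_bigr => p _; rewrite !iso_frame_even !iso_frame_odd; ring.
Qed.

Lemma iso_frame_low a i : (a < n)%N -> iso_allowed a i ->
  lowest iso_w (iso_frame a i) (iso_mon a i) /\ wt iso_w (iso_mon a i) = iso_om a i.
Proof.
rewrite /iso_allowed => lt_a le_ia; have lt_i : (i < r)%N by lia.
have lt_p : (a./2 < r)%N by lia.
have lt_in : (i < n)%N by lia.
have lt_2in : (i.*2 < n)%N by lia.
split; last first.
  rewrite /iso_mon wtD wtU /iso_w weight_ofE // eqxx; case: (eqVneq a i.*2) => [->|neq].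
    by rewrite wt0 /iso_om; lia.
  by rewrite wtU weight_ofE // (negPf neq) /iso_om; lia.
rewrite /iso_frame !insubT /=; apply: lowestM; first exact: lowestX.
have := odd_double_half a; case: (boolP (odd a)) => odd_a eq_a.
  have neq : a == i.*2 = false by lia.
  rewrite neq dual_part_free /=; last by lia.
  by move: eq_a; rewrite add1n => ->; apply: lowestX.
rewrite mxE -val_eqE /=; case: eqP => [eq_p|neq].
  have -> : a == i.*2 by lia.
  exact: lowest1.
have -> : a == i.*2 = false by lia.
have -> : (i < a./2)%N by lia.
by move: eq_a; rewrite add0n => ->; apply: lowestX.
Qed.

Lemma iso_frame_ge a i : (a < n)%N -> wt_ge iso_w (iso_om a i) (iso_frame a i).
Proof.
move=> lt_a; case: (boolP (iso_allowed a i)) => [al|].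
  by have [/lowest_ge + <-] := iso_frame_low lt_a al.
rewrite /iso_allowed -ltnNge => lt_ai; rewrite /iso_frame.
case: insubP => [i' lt_i _|_]; last exact: wt_ge0.
case: insubP => [p _ eq_p|_]; last exact: wt_ge0.
have le_om : iso_om a i <= (3 * n * i)%:Z.
  have: 0 <= (i.*2%:Z - a%:Z) * (n%:Z - i%:Z) by apply: mulr_ge0; lia.
  by rewrite /iso_om; lia.
apply: wt_ge_weak le_om _; rewrite -[(_)%:Z]addr0; apply: wt_geM; last exact: wt_ge_nonneg.
have eqw : wt iso_w U_(var_index n i.*2 i)%MM = (3 * n * i)%:Z.
  by rewrite wtU /iso_w weight_ofE ?eqxx //; lia.
by rewrite -eqw; apply: wt_geX.
Qed.

(** Away from the positions [(2i, i)] the multiplicities are exponents of variables. The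
exponent of the variable that scales column [i] is the length of row [i] of the tableau,
which gives the remaining multiplicity. *)
Lemma iso_mon_sep (e e' : nat -> nat -> nat) :
  (forall a i, (a < n)%N -> (i < n)%N -> (0 < e a i)%N -> iso_allowed a i) ->
  (forall a i, (a < n)%N -> (i < n)%N -> (0 < e' a i)%N -> iso_allowed a i) ->
  (forall u, table_mon n iso_mon e u = table_mon n iso_mon e' u) ->
  forall a i, (a < n)%N -> (i < n)%N -> e a i = e' a i.
Proof.
have table_off e0 : (forall a i, (a < n)%N -> (i < n)%N -> (0 < e0 a i)%N -> iso_allowed a i) ->
    forall a0 i0, (a0 < n)%N -> (i0 < n)%N -> a0 != i0.*2 ->
    table_mon n iso_mon e0 (var_index n a0 i0) = e0 a0 i0.
  move=> al a0 i0 lt_a0 lt_i0 neq; rewrite -[RHS](@sum_delta n) //.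
  apply: eq_bigr => i _; apply: eq_bigr => a _.
  case: (posnP (e0 a i)) => [->|/(al _ _ (ltn_ord a) (ltn_ord i))]; first by rewrite !mul0n.
  rewrite /iso_allowed => le_ia; congr muln; have lt_2i := leq_ltn_trans le_ia (ltn_ord a).
  rewrite mnmDE mnm1E var_index_eq //; case: (eqVneq (a : nat) i.*2) => [eq_a|neq_a].
    by rewrite mnm0E; lia.
  by rewrite mnm1E var_index_eq //; lia.
have table_on e0 : (forall a i, (a < n)%N -> (i < n)%N -> (0 < e0 a i)%N -> iso_allowed a i) ->
    forall i0, (i0 < r)%N ->
    table_mon n iso_mon e0 (var_index n i0.*2 i0) = (\sum_(a < n) e0 a i0)%N.
  move=> al i0 lt_i0; have lt_2i0 : (i0.*2 < n)%N by lia.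
  have lt_i0n : (i0 < n)%N by lia.
  rewrite /table_mon (bigD1 (Ordinal lt_i0n)) //= [X in (_ + X)%N]big1 ?addn0.
    apply: eq_bigr => a _; rewrite mnmDE mnm1E eqxx; case: (eqVneq (a : nat) i0.*2) => [_|neq].
      by rewrite mnm0E addn0 muln1.
    by rewrite mnm1E var_index_eq // (negPf neq) addn0 muln1.
  move=> i /eqP neq; rewrite big1 // => a _.
  have {}neq : (i : nat) == i0 = false by apply/eqP => eq_i; apply: neq; apply: val_inj.
  case: (posnP (e0 a i)) => [->|/(al _ _ (ltn_ord a) (ltn_ord i))]; first by rewrite mul0n.
  rewrite /iso_allowed => le_ia; have lt_2i := leq_ltn_trans le_ia (ltn_ord a).
  rewrite mnmDE mnm1E var_index_eq // neq andbF add0n; case: ifP => _.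
    by rewrite mnm0E muln0.
  by rewrite mnm1E var_index_eq // neq andbF muln0.
move=> al al' eq_t a i lt_a lt_i; have [eq_a|neq] := eqVneq a i.*2; last first.
  by rewrite -(table_off e) // -(table_off e') // eq_t.
have lt_ir : (i < r)%N by lia.
have := eq_t (var_index n i.*2 i); rewrite !table_on //.
rewrite (bigD1 (Ordinal lt_a)) //= [RHS](bigD1 (Ordinal lt_a)) //=.
rewrite (eq_bigr (fun b : 'I_n => e' b i)) => [|b neq_b]; first by move/addIn.
have neq2 : (b : nat) != i.*2.
  by apply: contra neq_b => /eqP eq_b; apply/eqP/val_inj; rewrite /= eq_b.
by rewrite -(table_off e) // -(table_off e') // eq_t.
Qed.
End SymplecticFrame.

(** * The generic point of V *)

Lemma monic_dvd_Xn (R : idomainType) (p q : {poly R}) m :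
  p * q = 'X^m -> p \is monic -> exists k, p = 'X^k.
Proof.
elim: m p q => [|m IH] p q eq_pq mon_p.
  exists 0%N; rewrite expr0.
  have q0 : q != 0 by apply: contra_eq_neq eq_pq => ->; rewrite mulr0 eq_sym expr0 oner_eq0.
  have := size_monicM mon_p q0; rewrite eq_pq expr0 size_poly1.
  have := size_poly_gt0 q; have := size_poly_gt0 p; rewrite q0 (monic_neq0 mon_p) => p_gt0 q_gt0 sz.
  have sz_p : size p = 1%N by lia.
  have /eqP := monicP mon_p; rewrite lead_coefE sz_p /= => /eqP p00.
  by rewrite (size1_polyC (eq_leq sz_p)) p00.
have: root (p * q) 0 by rewrite eq_pq /root hornerXn exprS mul0r.
rewrite rootM => /orP[] /factor_theorem[f eq_f]; rewrite polyC0 subr0 in eq_f.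
  have mon_f : f \is monic by move: mon_p; rewrite eq_f monicMr ?monicX.
  have [|k eq_k] := IH f q _ mon_f; last by exists k.+1; rewrite eq_f eq_k exprSr.
  by apply: (@mulIf _ 'X); rewrite ?polyX_eq0 // -exprSr -eq_pq eq_f; ring.
apply: (IH p f) => //.
by apply: (@mulIf _ 'X); rewrite ?polyX_eq0 // -exprSr -eq_pq eq_f; ring.
Qed.

(** Since (T - A) (T + A) = T^2, the characteristic polynomial divides a power of T. *)
Lemma char_poly_square0 (R : idomainType) n (A : 'M[R]_n) : A *m A = 0 -> char_poly A = 'X^n.
Proof.
move=> AA0.
have eq_prod : char_poly A * char_poly (- A) = 'X^(n + n).
  rewrite /char_poly -det_mulmx /char_poly_mx.
  have -> : map_mx polyC (- A) = - map_mx polyC A by rewrite map_mxN.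
  set B := map_mx polyC A.
  have BB0 : B *m B = 0 by rewrite -map_mxM AA0 map_mx0.
  rewrite opprK mulmxBl !mulmxDr BB0 addr0 (scalar_mxC _ B) addrK -scalar_mxM det_scalar.
  by rewrite exprMn -exprD.
have [k eqk] := monic_dvd_Xn eq_prod (char_poly_monic A).
by have := size_char_poly A; rewrite eqk size_polyXn => -[->].
Qed.

Section FrameMap.
Variables (F : fieldType) (r : nat) (r_gt0 : (0 < r)%N) (N d : nat).
Local Notation D := {mpoly F[N]}.
Local Notation P := (mxpolyring F (r + r)).
Local Notation Y := (generic_mx F (r + r)).
Variable c : nat -> nat -> D.

Lemma blocksC d' k a b : blocks c d' k a b = - blocks c d' k b a.
Proof. by elim: d' k => [|d' IH] k /=; [rewrite oppr0 | rewrite IH; ring]. Qed.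

Lemma blocksxx d' k a : blocks c d' k a a = 0.
Proof. by elim: d' k => [|d' IH] k //=; rewrite IH; ring. Qed.

Definition frame_mx : 'M[D]_(r + r) :=
  \matrix_(i, j) blocks c d 0 (letter_of i) (letter_of j).

(** The morphism Y |-> C Omega C^T. *)
Definition frame_map : {rmorphism P -> D} :=
  comp_mpoly [tuple mxvec frame_mx 0 k | k < (r + r) * (r + r)].

Lemma frame_mapZ a p : frame_map (a *: p) = a *: frame_map p.
Proof. exact: comp_mpolyZ. Qed.

Lemma frame_map_generic : map_mx frame_map Y = frame_mx.
Proof.
apply/matrixP => i j; rewrite !mxE /= comp_mpolyXU -tnth_nth tnth_mktuple mxvecE.
by rewrite mxE.
Qed.

Lemma frame_map_gen i j : frame_map (Y i j) = blocks c d 0 (letter_of i) (letter_of j).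
Proof.
by have := congr1 (fun A : 'M_(r + r) => A i j) frame_map_generic; rewrite !mxE.
Qed.

Lemma frame_map_entry a b : (a < r.*2)%N -> (b < r.*2)%N ->
  frame_map (entry F r_gt0 a b) = blocks c d 0 a b.
Proof.
move=> lt_a lt_b; rewrite /entry; case: (ssrnat.ltngtP a b) => [_|_|->].
- by rewrite frame_map_gen !index_ofK.
- by rewrite rmorphN frame_map_gen !index_ofK // -blocksC.
by rewrite rmorph0 blocksxx.
Qed.

Hypothesis iso : forall i j,
  \sum_(p < r) (c p.*2 i * c p.*2.+1 j - c p.*2.+1 i * c p.*2 j) = 0.

Let form (u v : nat -> D) := \sum_(p < r) (u p.*2 * v p.*2.+1 - u p.*2.+1 * v p.*2).

Lemma formC u v : form u v = - form v u.
Proof. by rewrite /form -sumrN; apply: eq_bigr => p _; ring. Qed.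

Lemma form_blocksl d' k a v : (forall i, form (c^~ i) v = 0) ->
  form (fun x => blocks c d' k x a) v = 0.
Proof.
move=> v_iso; elim: d' k => [|d' IH] k /=.
  by rewrite /form big1 // => p _; rewrite !mul0r subrr.
have -> : form (fun x => blocks c d' k.+1 x a + (c x k.*2 * c a k.*2.+1 - c x k.*2.+1 * c a k.*2)) v =
    form (fun x => blocks c d' k.+1 x a) v +
    (c a k.*2.+1 * form (c^~ k.*2) v - c a k.*2 * form (c^~ k.*2.+1) v).
  by rewrite /form !mulr_sumr -sumrB -big_split; apply: eq_bigr => p _ /=; ring.
by rewrite IH !v_iso !mulr0 subrr addr0.
Qed.

Lemma form_blocks d' k a b : form (fun x => blocks c d' k x a) (fun x => blocks c d' k x b) = 0.
Proof.
apply: form_blocksl => i; rewrite formC form_blocksl ?oppr0 // => j.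
exact: iso.
Qed.

Local Notation J := (symplectic_mx D r).

Lemma frame_mx_isotropic : frame_mx^T *m J *m frame_mx = 0.
Proof.
apply/matrixP => i j; rewrite symplectic_form mxE.
rewrite -[RHS](form_blocks d 0 (letter_of i) (letter_of j)); apply: eq_bigr => p _.
by rewrite ![frame_mx _ _]mxE !letter_of_l !letter_of_r.
Qed.

Lemma frame_mxT : frame_mx^T = - frame_mx.
Proof. by apply/matrixP => i j; rewrite !mxE -blocksC. Qed.

Lemma frame_map_equation p : V_equation p -> frame_map p = 0.
Proof.
have mapJ : map_mx frame_map (symplectic_mx P r) = J.
  by rewrite map_block_mx map_mx0 map_mxN map_mx1.
case=> [i j|i|i j|k].
- have -> : (- Y^T) i j = - Y j i by rewrite !mxE.
  by rewrite rmorphB rmorphN !frame_map_gen -blocksC subrr.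
- by rewrite frame_map_gen blocksxx.
- have -> : frame_map ((Y^T *m symplectic_mx P r *m Y) i j) =
      (map_mx frame_map (Y^T *m symplectic_mx P r *m Y)) i j by rewrite [RHS]mxE.
  by rewrite !map_mxM -map_trmx mapJ frame_map_generic frame_mx_isotropic mxE.
rewrite rmorphB -!(coef_map frame_map) map_polyXn map_char_poly map_mxN map_mxM mapJ.
rewrite frame_map_generic char_poly_square0 ?subrr //.
rewrite mulmxN mulNmx opprK -mulmxA [frame_mx *m _]mulmxA.
have -> : frame_mx *m J *m frame_mx = 0.
  by rewrite -[X in X *m J]opprK -frame_mxT !mulNmx frame_mx_isotropic oppr0.
by rewrite mulmx0.
Qed.

Lemma frame_map_ideal p : p \in @V_ideal F r -> frame_map p = 0.
Proof.
move=> /asboolP[k [a [g [Vg ->]]]]; rewrite rmorph_sum big1 // => i _.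
by rewrite rmorphM /= (frame_map_equation (Vg i)) mulr0.
Qed.
End FrameMap.

Section Main.
Variables (F : fieldType) (r : nat) (r_gt0 : (0 < r)%N) (r_even : ~~ odd r).
Hypothesis two_neq0 : 2%:R != 0 :> F.
Hypothesis fact_neq0 : forall m, (m <= r)%N -> m`!%:R != 0 :> F.
Local Notation n := r.*2.
Local Notation P := (mxpolyring F (r + r)).
Local Notation y := (entry F r_gt0).

Lemma std_basis k v : has_content n y k v ->
  spanned (fun u => exists lam, [/\ std_pattern n lam, pattern_content n k lam &
    u = std_product n y lam]) v.
Proof.
apply: (has_content_std (entryxx F r_gt0) (entryC F r_gt0)); last by rewrite odd_double.
move=> J lam a std_lam lam_inj.
have sep (e e' : nat -> nat -> nat) :
    (forall a i, (a < n)%N -> (i < n)%N -> (0 < e a i)%N -> free_allowed n a i) ->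
    (forall a i, (a < n)%N -> (i < n)%N -> (0 < e' a i)%N -> free_allowed n a i) ->
    (forall u, table_mon n (@free_mon n) e u = table_mon n (@free_mon n) e' u) ->
    forall a i, (a < n)%N -> (i < n)%N -> e a i = e' a i.
  by move=> _ _; apply: free_mon_sep.
have phi_y a' b : (a' < n)%N -> (b < n)%N ->
    frame_map r r (@free_frame F n) (y a' b) = blocks (@free_frame F n) r 0 a' b.
  exact: frame_map_entry.
apply: (admissible_free (free_om_sub (n:=n)) (free_om_incr (n:=n)) (@free_frame_ge F n) (@free_frame_low F n)
  sep (@frame_mapZ F r _ r (@free_frame F n)) phi_y) => //.
move=> j; split=> //; last by move=> j'; apply: height_le.
move=> i j'; rewrite -height_gt; last by have [] := std_lam j.
by move=> lt_i; apply: leq_trans lt_i (height_le _ _ _).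
Qed.

(** A symplectic column has at most [r] letters, and [r] is even: half of [r] pairs of
columns of the frame suffice. *)
Lemma symplectic_admissible lam : symplectic r lam ->
  admissible n (r./2) iso_allowed lam.
Proof.
case=> -[gt even] sym; split=> // [i j lt_j|j].
  apply: leq_trans (sym i _) _; first by apply: leq_ltn_trans lt_j.
  exact: letter_incr.
rewrite even_halfK // leqNgt height_gt //; apply/negP => lt_j.
have := sym r (leq_ltn_trans (leq0n _) lt_j).
by rewrite leqNgt letter_lt // (leq_ltn_trans _ lt_j).
Qed.

Definition generic_point := frame_map r (r./2) (@iso_frame F r).

Lemma generic_point_ideal (p : P) : p \in @V_ideal F r -> generic_point p = 0.
Proof. by apply: frame_map_ideal; apply: iso_frame_isotropic. Qed.

(** Modulo the ideal, a polynomial is a combination of products of symplectic tableaux; if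
it lies in the kernel, so does this combination, which then vanishes. *)
Lemma generic_point_kernel (p : P) : generic_point p = 0 -> p \in @V_ideal F r.
Proof.
move=> phi_p0; have [u Su pu] := content_mod r_gt0 p.
have red_content k v := content_reducible (entryxx F r_gt0) (entryC F r_gt0) two_neq0 fact_neq0
  (entry_trace r_gt0 two_neq0) (entry_isotropic F r_gt0) std_basis (k := k) (v := v).
have [u' Su' pu'] : reducible (@V_ideal F r) r y p.
  apply: reducible_mod pu _; apply: reducible_spanned Su => v [k cv].
  exact: red_content cv.
suff u'0 : u' = 0 by rewrite -[p](subr0) -u'0.
have phi_y a b : (a < n)%N -> (b < n)%N ->
    generic_point (y a b) = blocks (@iso_frame F r) r./2 0 a b.
  exact: frame_map_entry.
apply: (spanned_admissible_inj (@iso_om_sub r) (@iso_om_incr r) (@iso_frame_ge F r) (@iso_frame_low F r)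
  (@iso_mon_sep r) (@frame_mapZ F r _ r./2 (@iso_frame F r)) phi_y).
  by apply: spanned_sub Su' => v [lam /symplectic_admissible adm ->]; apply: spanned_in; exists lam.
by have := generic_point_ideal pu'; rewrite rmorphB phi_p0 sub0r => /eqP; rewrite oppr_eq0 => /eqP.
Qed.
End Main.

Lemma quotient_domain (R : comNzRingType) (I : idealr R) :
    (forall u v, u * v \in I -> u \in I \/ v \in I) ->
  is_integral_domain {ideal_quot I}.
Proof.
move=> primeI; split=> [|x y]; first by apply/eqP/oner_neq0.
have pi0 (u : R) : u \in I -> (\pi_({ideal_quot I}) u)%qT = 0.
  by move=> uI; apply/eqP; rewrite !piE Quotient.equivE subr0.
move=> /eqP xy0; have: repr x * repr y \in I.
  by move: xy0; rewrite -[x]reprK -[y]reprK !piE Quotient.equivE subr0 !reprK.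
by case/primeI => /pi0; rewrite reprK => eq0; [left | right].
Qed.

Unset Implicit Arguments.

Theorem theorem4p3 (F : fieldType) (r : nat)
    (n_gt0 : (0 < r + r)%N) (n_mult4 : (4 %| r + r)%N)
    (charF : [pchar F] =i pred0 \/ (exists2 p : nat, p \in [pchar F] & (r < p)%N)) :
  is_integral_domain (coordinate_ring F r).
Proof.
have r_gt0 : (0 < r)%N by lia.
have r_even : ~~ odd r by lia.
have nat_neq0 m : (0 < m <= r)%N -> m%:R != 0 :> F.
  case: charF => [/pcharf0P F0|[p pF lt_rp]] /andP[m_gt0 le_mr].
    by rewrite F0 -lt0n.
  rewrite -(dvdn_pcharf pF) gtnNdvd //; exact: leq_ltn_trans le_mr lt_rp.
have two_neq0 : 2%:R != 0 :> F by apply: nat_neq0; lia.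
have fact_neq0 m : (m <= r)%N -> m`!%:R != 0 :> F.
  elim: m => [|m IH] le_mr; first exact: oner_neq0.
  by rewrite factS natrM; apply: mulf_neq0; [exact: nat_neq0 | exact/IH/ltnW].
apply: quotient_domain => u v /(generic_point_ideal (r:=r)) /eqP.
rewrite rmorphM mulf_eq0 => /orP[] /eqP phi0; [left|right].
  exact: (generic_point_kernel r_gt0 r_even two_neq0 fact_neq0).
exact: (generic_point_kernel r_gt0 r_even two_neq0 fact_neq0).
Qed.
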